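(* It is provable in $\mathbf{ZF}$ that every metrizable Cantor cube is paracompact.
   Context: The base theory is $\mathbf{ZF}$, with no form of the axiom of choice assumed. A Cantor cube is a space $\mathbf{2}^X$, where $X$ is a non-empty set: the set $\{0,1\}^X$ with the Tychonoff product topology, $\{0,1\}$ being discrete. A topological space is paracompact if every open cover of it has a locally finite open refinement (a family is locally finite if every point has a neighborhood meeting only finitely many of its members). *)

(* Defs.v *)
(* ZF is treated as a first-order theory: formulas of the language
   {=, ∈}, classical natural deduction, the axioms of ZF, and derivability from
   them.  No axiom of Rocq's own logic enters the notion "provable in ZF". *)
From Stdlib Require Import List.
Import ListNotations.

(** * First-order logic over {=, ∈} *)

(* De Bruijn indices; the language has no function symbols, so the only terms
   are variables. *)
Inductive form : Type :=
| Bot : form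
| Eq  : nat -> nat -> form
| Mem : nat -> nat -> form
| Imp : form -> form -> form
| All : form -> form.

Definition up (r : nat -> nat) (i : nat) : nat :=
  match i with 0 => 0 | S j => S (r j) end.

Fixpoint ren (r : nat -> nat) (p : form) : form :=
  match p with
  | Bot => Bot
  | Eq i j => Eq (r i) (r j)
  | Mem i j => Mem (r i) (r j)
  | Imp p q => Imp (ren r p) (ren r q)
  | All p => All (ren (up r) p)
  end.

Definition scons (t : nat) (i : nat) : nat :=
  match i with 0 => t | S j => j end.

Definition subst0 (t : nat) (p : form) : form := ren (scons t) p.

(* All free variables of the formula are among 0, ..., n-1. *)
Fixpoint fv_below (n : nat) (p : form) : Prop :=
  match p with
  | Bot => True
  | Eq i j | Mem i j => i < n /\ j < n
  | Imp p q => fv_below n p /\ fv_below n q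
  | All p => fv_below (S n) p
  end.

Inductive nd : list form -> form -> Prop :=
| nd_hyp G p : In p G -> nd G p
| nd_impI G p q : nd (p :: G) q -> nd G (Imp p q)
| nd_impE G p q : nd G (Imp p q) -> nd G p -> nd G q
| nd_raa G p : nd (Imp p Bot :: G) Bot -> nd G p
| nd_allI G p : nd (map (ren S) G) p -> nd G (All p)
| nd_allE G p t : nd G (All p) -> nd G (subst0 t p)
| nd_eqI G t : nd G (Eq t t)
| nd_eqE G p s t : nd G (Eq s t) -> nd G (subst0 s p) -> nd G (subst0 t p).

Definition provable (T : form -> Prop) (p : form) : Prop :=
  exists G, (forall q, In q G -> T q) /\ nd G p.

(** * Writing formulas with named variables *)

(* A [fml] is a formula waiting for the number [d] of quantifiers above it.
   Variables are de Bruijn levels, so the variable bound by the outermost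
   quantifier is 0 whatever the depth at which it is used; an atom turns the
   level x into the index d - 1 - x. *)
Definition var : Type := nat.
Definition fml : Type := nat -> form.

Definition sentence (p : fml) : form := p 0.

Definition fmem (x y : var) : fml := fun d => Mem (d - S x) (d - S y).
Definition feq (x y : var) : fml := fun d => Eq (d - S x) (d - S y).
Definition fbot : fml := fun _ => Bot.
Definition fimp (p q : fml) : fml := fun d => Imp (p d) (q d).
Definition fall (p : var -> fml) : fml := fun d => All (p d (S d)).

Definition fnot (p : fml) : fml := fimp p fbot.
Definition fand (p q : fml) : fml := fnot (fimp p (fnot q)).
Definition for_ (p q : fml) : fml := fimp (fnot p) q.
Definition fiff (p q : fml) : fml := fand (fimp p q) (fimp q p).
Definition fex (p : var -> fml) : fml := fnot (fall (fun x => fnot (p x))).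
Definition fall_in (a : var) (p : var -> fml) : fml :=
  fall (fun x => fimp (fmem x a) (p x)).
Definition fex_in (a : var) (p : var -> fml) : fml :=
  fex (fun x => fand (fmem x a) (p x)).
Definition fex1 (p : var -> fml) : fml :=
  fex (fun x => fand (p x) (fall (fun y => fimp (p y) (feq y x)))).

Fixpoint falls (n : nat) (p : list var -> fml) : fml :=
  match n with
  | 0 => p []
  | S m => fall (fun x => falls m (fun xs => p (x :: xs)))
  end.

(* [p] with its free variables 0, 1, ... replaced by the variables in [xs]. *)
Definition finst (p : form) (xs : list var) : fml :=
  fun d => ren (fun i => d - S (nth i xs 0)) p.

Declare Scope fml_scope.
Delimit Scope fml_scope with fml.
Bind Scope fml_scope with fml.

Notation "x ∈ y" := (fmem x y) (at level 70, no associativity) : fml_scope.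
Notation "x ≐ y" := (feq x y) (at level 70, no associativity) : fml_scope.
Notation "¬ p" := (fnot p) (at level 75, right associativity) : fml_scope.
Notation "p ∧ q" := (fand p q) (at level 80, right associativity) : fml_scope.
Notation "p ∨ q" := (for_ p q) (at level 85, right associativity) : fml_scope.
Notation "p ⇒ q" := (fimp p q) (at level 90, right associativity) : fml_scope.
Notation "p ⇔ q" := (fiff p q) (at level 95, no associativity) : fml_scope.
Notation "∀ x .. y , p" := (fall (fun x => .. (fall (fun y => p)) ..))
  (at level 200, x binder, y binder, right associativity) : fml_scope.
Notation "∃ x .. y , p" := (fex (fun x => .. (fex (fun y => p)) ..))
  (at level 200, x binder, y binder, right associativity) : fml_scope.
Notation "∃! x , p" := (fex1 (fun x => p))
  (at level 200, x name, right associativity) : fml_scope.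
Notation "∀[ x ∈ a ] p" := (fall_in a (fun x => p))
  (at level 200, x name, a at level 69, right associativity) : fml_scope.
Notation "∃[ x ∈ a ] p" := (fex_in a (fun x => p))
  (at level 200, x name, a at level 69, right associativity) : fml_scope.

Local Open Scope fml_scope.

(** * Elementary set theory *)

Definition Subset (a b : var) : fml := ∀[x ∈ a] x ∈ b.
Definition Empty (a : var) : fml := ∀ x, ¬ x ∈ a.
Definition Nonempty (a : var) : fml := ∃ x, x ∈ a.
Definition IsPowerset (p a : var) : fml := ∀ x, x ∈ p ⇔ Subset x a.
Definition IsUnion (u a : var) : fml := ∀ x, x ∈ u ⇔ ∃[y ∈ a] x ∈ y.
Definition IsInter (w u v : var) : fml := ∀ x, x ∈ w ⇔ x ∈ u ∧ x ∈ v.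
Definition IsPair (p x y : var) : fml := ∀ z, z ∈ p ⇔ z ≐ x ∨ z ≐ y.

(* p = (x, y) = {{x}, {x, y}} *)
Definition IsOPair (p x y : var) : fml :=
  ∃ u v, IsPair u x x ∧ IsPair v x y ∧ IsPair p u v.

Definition IsProduct (c a b : var) : fml :=
  ∀ p, p ∈ c ⇔ ∃[x ∈ a] ∃[y ∈ b] IsOPair p x y.

(* (x, y) ∈ f; for a function f this says f(x) = y. *)
Definition App (f x y : var) : fml := ∃[p ∈ f] IsOPair p x y.
(* f((x, y)) = z *)
Definition App2 (f x y z : var) : fml := ∃ p, IsOPair p x y ∧ App f p z.

Definition IsRel (r a b : var) : fml :=
  ∀[p ∈ r] ∃[x ∈ a] ∃[y ∈ b] IsOPair p x y.
Definition IsFun (f a b : var) : fml :=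
  IsRel f a b ∧ ∀[x ∈ a] ∃! y, App f x y.
Definition IsFun2 (f a b c : var) : fml := ∃ q, IsProduct q a b ∧ IsFun f q c.
Definition IsBij (f a b : var) : fml :=
  IsFun f a b ∧ ∀[y ∈ b] ∃! x, App f x y.
(* e = the set of all functions from a to b *)
Definition IsFunSet (e a b : var) : fml := ∀ f, f ∈ e ⇔ IsFun f a b.

Definition IsSucc (s n : var) : fml := ∀ z, z ∈ s ⇔ z ∈ n ∨ z ≐ n.
Definition Inductive_ (w : var) : fml :=
  (∃[e ∈ w] Empty e) ∧ ∀[n ∈ w] ∃[s ∈ w] IsSucc s n.
(* n ∈ ω *)
Definition IsNat (n : var) : fml := ∀ w, Inductive_ w ⇒ n ∈ w.
Definition Finite (a : var) : fml := ∃ n f, IsNat n ∧ IsBij f a n.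
(* t = {0, 1} *)
Definition IsTwo (t : var) : fml :=
  ∃ z o, Empty z ∧ IsSucc o z ∧ IsPair t z o.

(** * The axioms of ZF *)

Inductive ZF : form -> Prop :=
| ZF_extensionality :
    ZF (sentence (∀ a b, (∀ x, x ∈ a ⇔ x ∈ b) ⇒ a ≐ b))
| ZF_foundation :
    ZF (sentence (∀ a, Nonempty a ⇒ ∃[x ∈ a] ¬ ∃[y ∈ x] y ∈ a))
| ZF_pairing :
    ZF (sentence (∀ x y, ∃ p, IsPair p x y))
| ZF_union :
    ZF (sentence (∀ a, ∃ u, IsUnion u a))
| ZF_powerset :
    ZF (sentence (∀ a, ∃ p, IsPowerset p a))
| ZF_infinity :
    ZF (sentence (∃ w, Inductive_ w))
| ZF_separation (n : nat) (p : form) : fv_below (1 + n) p ->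
    ZF (sentence (falls n (fun ps =>
      ∀ a, ∃ b, ∀ x, x ∈ b ⇔ x ∈ a ∧ finst p (x :: ps))))
| ZF_replacement (n : nat) (p : form) : fv_below (2 + n) p ->
    ZF (sentence (falls n (fun ps =>
      ∀ a, (∀[x ∈ a] ∃! y, finst p (x :: y :: ps)) ⇒
        ∃ b, ∀ y, y ∈ b ⇔ ∃[x ∈ a] finst p (x :: y :: ps)))).

(** * The real numbers *)

(* The field operations [add], [mul] are functions K × K → K and [lt] is a
   relation on K. *)
Definition IsField (K add mul zero one : var) : fml :=
  IsFun2 add K K K ∧ IsFun2 mul K K K ∧ zero ∈ K ∧ one ∈ K ∧ ¬ zero ≐ one ∧
  (∀[x ∈ K] ∀[y ∈ K] ∀[s ∈ K] App2 add x y s ⇒ App2 add y x s) ∧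
  (∀[x ∈ K] ∀[y ∈ K] ∀[z ∈ K] ∀[u ∈ K] ∀[v ∈ K] ∀[s ∈ K]
     App2 add x y u ∧ App2 add y z v ∧ App2 add u z s ⇒ App2 add x v s) ∧
  (∀[x ∈ K] App2 add x zero x) ∧
  (∀[x ∈ K] ∃[y ∈ K] App2 add x y zero) ∧
  (∀[x ∈ K] ∀[y ∈ K] ∀[s ∈ K] App2 mul x y s ⇒ App2 mul y x s) ∧
  (∀[x ∈ K] ∀[y ∈ K] ∀[z ∈ K] ∀[u ∈ K] ∀[v ∈ K] ∀[s ∈ K]
     App2 mul x y u ∧ App2 mul y z v ∧ App2 mul u z s ⇒ App2 mul x v s) ∧
  (∀[x ∈ K] App2 mul x one x) ∧
  (∀[x ∈ K] ¬ x ≐ zero ⇒ ∃[y ∈ K] App2 mul x y one) ∧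
  (∀[x ∈ K] ∀[y ∈ K] ∀[z ∈ K] ∀[s ∈ K] ∀[u ∈ K] ∀[v ∈ K] ∀[t ∈ K]
     App2 add y z s ∧ App2 mul x y u ∧ App2 mul x z v ∧ App2 add u v t ⇒
     App2 mul x s t).

Definition IsOrderedField (K add mul lt zero one : var) : fml :=
  IsField K add mul zero one ∧
  IsRel lt K K ∧
  (∀[x ∈ K] ¬ App lt x x) ∧
  (∀[x ∈ K] ∀[y ∈ K] ∀[z ∈ K] App lt x y ∧ App lt y z ⇒ App lt x z) ∧
  (∀[x ∈ K] ∀[y ∈ K] App lt x y ∨ x ≐ y ∨ App lt y x) ∧
  (∀[x ∈ K] ∀[y ∈ K] ∀[z ∈ K] ∀[u ∈ K] ∀[v ∈ K]
     App lt x y ∧ App2 add x z u ∧ App2 add y z v ⇒ App lt u v) ∧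
  (∀[x ∈ K] ∀[y ∈ K] ∀[u ∈ K]
     App lt zero x ∧ App lt zero y ∧ App2 mul x y u ⇒ App lt zero u).

Definition IsUpperBound (K lt s b : var) : fml :=
  b ∈ K ∧ ∀[x ∈ s] ¬ App lt b x.

(* "The" real numbers: a Dedekind-complete ordered field, which ZF proves to
   exist and to be unique up to isomorphism. *)
Definition IsReals (K add mul lt zero one : var) : fml :=
  IsOrderedField K add mul lt zero one ∧
  ∀ s, Subset s K ∧ Nonempty s ∧ (∃ b, IsUpperBound K lt s b) ⇒
    ∃ l, IsUpperBound K lt s l ∧
      ∀ b, IsUpperBound K lt s b ⇒ ¬ App lt b l.

(** * Topology *)

(* The empty set is open as the union of the empty family. *)
Definition IsTopology (T C : var) : fml :=
  (∀[u ∈ T] Subset u C) ∧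
  C ∈ T ∧
  (∀ F u, Subset F T ∧ IsUnion u F ⇒ u ∈ T) ∧
  (∀[u ∈ T] ∀[v ∈ T] ∀ w, IsInter w u v ⇒ w ∈ T).

Definition IsMetric (d C K add lt zero : var) : fml :=
  IsFun2 d C C K ∧
  (∀[x ∈ C] ∀[y ∈ C] ∀[r ∈ K] App2 d x y r ⇒ ¬ App lt r zero) ∧
  (∀[x ∈ C] ∀[y ∈ C] App2 d x y zero ⇔ x ≐ y) ∧
  (∀[x ∈ C] ∀[y ∈ C] ∀[r ∈ K] App2 d x y r ⇒ App2 d y x r) ∧
  (∀[x ∈ C] ∀[y ∈ C] ∀[z ∈ C] ∀[r ∈ K] ∀[s ∈ K] ∀[t ∈ K] ∀[u ∈ K]
     App2 d x y r ∧ App2 d y z s ∧ App2 d x z t ∧ App2 add r s u ⇒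
     ¬ App lt u t).

(* b = {y ∈ C : d(x, y) < e} *)
Definition IsBall (b x e d C lt : var) : fml :=
  ∀ y, y ∈ b ⇔ y ∈ C ∧ ∃ r, App2 d x y r ∧ App lt r e.

Definition MetricInduces (d C K lt zero T : var) : fml :=
  ∀ u, u ∈ T ⇔ Subset u C ∧
    ∀[x ∈ u] ∃[e ∈ K] App lt zero e ∧
      ∃ b, IsBall b x e d C lt ∧ Subset b u.

Definition Metrizable (C T : var) : fml :=
  ∃ K add mul lt zero one, IsReals K add mul lt zero one ∧
    ∃ d, IsMetric d C K add lt zero ∧ MetricInduces d C K lt zero T.

Definition OpenCover (U C T : var) : fml :=
  Subset U T ∧ ∀[x ∈ C] ∃[u ∈ U] x ∈ u.

Definition Refines (V U : var) : fml := ∀[v ∈ V] ∃[u ∈ U] Subset v u.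

Definition Neighborhood (N x C T : var) : fml :=
  Subset N C ∧ ∃[u ∈ T] x ∈ u ∧ Subset u N.

Definition LocallyFinite (V C T : var) : fml :=
  ∀[x ∈ C] ∃ N, Neighborhood N x C T ∧
    ∃ M, (∀ v, v ∈ M ⇔ v ∈ V ∧ ∃[y ∈ v] y ∈ N) ∧ Finite M.

Definition Paracompact (C T : var) : fml :=
  ∀ U, OpenCover U C T ⇒
    ∃ V, OpenCover V C T ∧ Refines V U ∧ LocallyFinite V C T.

(** * Cantor cubes *)

(* b = {f ∈ C : f(x) ∈ v}, the preimage of v under the projection at x *)
Definition IsCylinder (b x v C : var) : fml :=
  ∀ f, f ∈ b ⇔ f ∈ C ∧ ∃[y ∈ v] App f x y.

Definition ProjectionsContinuous (T C X S : var) : fml :=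
  ∀[x ∈ X] ∀[v ∈ S] ∀ b, IsCylinder b x v C ⇒ b ∈ T.

(* T is the product topology on the set C of all functions from X to a space
   with topology S: the coarsest one making all projections continuous. *)
Definition IsTychonoff (T C X S : var) : fml :=
  IsTopology T C ∧ ProjectionsContinuous T C X S ∧
  ∀ T', IsTopology T' C ∧ ProjectionsContinuous T' C X S ⇒ Subset T T'.

(* (C, T) is 2^X; the discrete topology is the powerset of {0, 1}. *)
Definition IsCantorCube (C T X : var) : fml :=
  ∃ two S, IsTwo two ∧ IsPowerset S two ∧
    IsFunSet C X two ∧ IsTychonoff T C X S.

(* Main.v *)
(* By completeness it suffices to argue in an arbitrary model of ZF.  Let d be a
   metric on 2^X, let 0 be the zero function and let e_x be the indicator of {x}.
   Every ball around 0 contains all but finitely many e_x, so each set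
   F_x = {y : d(0, e_y) >= d(0, e_x)} is finite; these sets form a chain that is
   cofinal in the finite subsets of X.  Given an open cover U and f in 2^X, let
   F(f) be the least F in the chain such that the clopen box of all g agreeing
   with f on F lies in some member of U.  It exists without any choice, since a
   chain of finite sets has a least element.  If g lies in the box of f then
   F(g) = F(f), so the boxes form a partition of 2^X into open sets, which is a
   locally finite refinement of U. *)

(* The choice operator of Rocq's logic enters only the construction of the term model; it yields no
   choice inside a model, which is a bare relation [E] whose sets come from the ZF axioms. Hence
   every set formed in a model must be cut out by a formula: predicates stay first-order so that
   [definable] can be settled mechanically, and distances or F(f) are relations with unique values
   rather than chosen functions. The obstacle is that refining a cover asks for one finite set of
   coordinates per point, while a bare set X distinguishes no finite subset from another. The metric
   removes it by putting a linear preorder on the coordinates, through the distances d(0, e_x). A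
   model may have nonstandard natural numbers, so finiteness has to be the model's own. For sets of
   coordinates it is taken in Kuratowski's form, whose induction principle follows from power set
   and separation; bijections with a natural number occur only for singletons. *)
From Stdlib Require Import List Lia Arith Cantor.
From Stdlib Require Import Classical ClassicalEpsilon FunctionalExtensionality
  PropExtensionality ProofIrrelevance.
Require Import Defs.
Import ListNotations.

(** * Natural deduction *)

Lemma ren_ext r s p : (forall i, r i = s i) -> ren r p = ren s p.
Proof.
  revert r s; induction p; intros r s H; simpl; try (now rewrite ?H); f_equal; auto.
  apply IHp; intros [|i]; simpl; auto.
Qed.

Lemma ren_ren r s p : ren r (ren s p) = ren (fun i => r (s i)) p.
Proof.
  revert r s; induction p; intros r s; simpl; try (now auto); f_equal; auto.
  rewrite IHp; apply ren_ext; intros [|i]; reflexivity.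
Qed.

Lemma ren_id p : ren (fun i => i) p = p.
Proof.
  induction p; simpl; try (now auto); f_equal; auto.
  rewrite <- IHp at 2; apply ren_ext; intros [|i]; reflexivity.
Qed.

Fixpoint free (c : nat) (p : form) : Prop :=
  match p with
  | Bot => False
  | Eq i j | Mem i j => i = c \/ j = c
  | Imp p q => free c p \/ free c q
  | All p => free (S c) p
  end.

Lemma ren_ext_free r s p : (forall i, free i p -> r i = s i) -> ren r p = ren s p.
Proof.
  revert r s; induction p; intros r s H; simpl in *; f_equal; auto.
  apply IHp; intros [|i] Hi; simpl; auto.
Qed.

Lemma free_ren r p i : free i (ren r p) -> exists j, free j p /\ i = r j.
Proof.
  revert r i; induction p; intros r i H; simpl in *.
  - tauto.
  - destruct H; eauto.
  - destruct H; eauto.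
  - destruct H as [H|H]; [apply IHp1 in H | apply IHp2 in H];
      destruct H as (j & Hj & ->); eauto.
  - apply IHp in H as ([|j] & Hj & E); simpl in E; [discriminate|].
    injection E as ->; eauto.
Qed.

Lemma free_bound p : exists k, forall i, free i p -> i < k.
Proof.
  induction p as [| i j | i j | p [k Hk] q [l Hl] | p [k Hk]]; simpl.
  - exists 0; tauto.
  - exists (S (i + j)); lia.
  - exists (S (i + j)); lia.
  - exists (k + l); intros i [H|H]; [apply Hk in H | apply Hl in H]; lia.
  - exists k; intros i H; apply Hk in H; lia.
Qed.

Lemma fv_below_free k p : (forall i, free i p -> i < k) -> fv_below k p.
Proof.
  revert k; induction p; intros k H; simpl in *; auto.
  apply IHp; intros [|i] Hi; [lia|]; apply H in Hi; lia.
Qed.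

Lemma nd_weaken G G' p : nd G p -> incl G G' -> nd G' p.
Proof.
  intros H; revert G'; induction H; intros G' HG.
  - apply nd_hyp; auto.
  - apply nd_impI, IHnd; intros x [<-|Hx]; simpl; auto.
  - eapply nd_impE; eauto.
  - apply nd_raa, IHnd; intros x [<-|Hx]; simpl; auto.
  - apply nd_allI, IHnd, incl_map, HG.
  - apply nd_allE; auto.
  - apply nd_eqI.
  - eapply nd_eqE; eauto.
Qed.

Lemma ren_subst0 r t p : ren r (subst0 t p) = subst0 (r t) (ren (up r) p).
Proof.
  unfold subst0; rewrite !ren_ren; apply ren_ext; intros [|i]; reflexivity.
Qed.

Lemma nd_ren G p r : nd G p -> nd (map (ren r) G) (ren r p).
Proof.
  intros H; revert r; induction H; intros r; simpl in *.
  - apply nd_hyp, in_map; auto.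
  - apply nd_impI; auto.
  - eapply nd_impE; [apply IHnd1 | apply IHnd2].
  - apply nd_raa; apply IHnd.
  - apply nd_allI. specialize (IHnd (up r)). rewrite map_map in *.
    erewrite map_ext; [exact IHnd|]; intros q; cbn.
    rewrite !ren_ren; apply ren_ext; reflexivity.
  - rewrite ren_subst0; apply nd_allE; auto.
  - apply nd_eqI.
  - rewrite ren_subst0 in *. eapply nd_eqE; [apply IHnd1|].
    rewrite <- ren_subst0; apply IHnd2.
Qed.

(* Renaming [c] to the bound variable and shifting all other variables turns a
   proof of the instance [subst0 c p] into the premise of [nd_allI]. *)
Lemma nd_generalize G p c :
  (forall q, In q G -> ~ free c q) -> ~ free c (All p) ->
  nd G (subst0 c p) -> nd G (All p).
Proof.
  intros HG Hp H; apply nd_allI.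
  set (r := fun i => if Nat.eq_dec i c then 0 else S i).
  apply (nd_ren _ _ r) in H.
  replace (ren r (subst0 c p)) with p in H.
  - erewrite map_ext_in; [exact H|]; intros q Hq.
    apply ren_ext_free; intros i Hi; unfold r.
    destruct Nat.eq_dec; [subst; now apply HG in Hq | reflexivity].
  - unfold subst0; rewrite ren_ren; rewrite <- (ren_id p) at 1.
    apply ren_ext_free; intros [|i] Hi; unfold r; simpl; destruct Nat.eq_dec;
      subst; simpl in *; tauto.
Qed.

(** * Theories and provability from them *)

Definition theory := form -> Prop.
Definition tadd (T : theory) (p : form) : theory := fun q => T q \/ q = p.
Definition consistent (T : theory) : Prop := ~ provable T Bot.

Lemma provable_hyp (T : theory) p : T p -> provable T p.
Proof.
  intros H; exists [p]; split; [intros q [<-|[]]; auto | apply nd_hyp; simpl; auto].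
Qed.

Lemma provable_mono (T T' : theory) p :
  provable T p -> (forall q, T q -> T' q) -> provable T' p.
Proof. intros (G & HG & H) HT; exists G; split; auto. Qed.

Lemma provable_deduction T p q : provable (tadd T p) q -> provable T (Imp p q).
Proof.
  intros (G & HG & H).
  assert (exists G', (forall x, In x G' -> T x) /\ incl G (p :: G')) as (G' & H1 & H2).
  { clear H; induction G as [|g G IH].
    - exists []; split; [intros x []|intros x []].
    - destruct IH as (G' & H1 & H2); [intros x Hx; apply HG; simpl; auto|].
      destruct (HG g (or_introl eq_refl)) as [Hg| ->].
      + exists (g :: G'); split; [intros x [<-|Hx]; auto|].
        intros x [<-|Hx]; simpl; auto; destruct (H2 x Hx); simpl; auto.
      + exists G'; split; auto; intros x [<-|Hx]; simpl; auto; apply H2; auto. }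
  exists G'; split; auto; apply nd_impI; eapply nd_weaken; eauto.
Qed.

Lemma provable_mp (T : theory) p q : provable T (Imp p q) -> provable T p -> provable T q.
Proof.
  intros (G & HG & H) (G' & HG' & H'); exists (G ++ G'); split.
  - intros x Hx; apply in_app_iff in Hx as [Hx|Hx]; auto.
  - eapply nd_impE; eapply nd_weaken; eauto; intros x Hx; apply in_app_iff; auto.
Qed.

Lemma provable_nd (T : theory) G p :
  (forall q, In q G -> provable T q) -> nd G p -> provable T p.
Proof.
  revert p; induction G as [|g G IH]; intros p HG H.
  - exists []; split; auto; intros x [].
  - apply provable_mp with g; [|apply HG; simpl; auto].
    apply IH; [intros q Hq; apply HG; simpl; auto|apply nd_impI; auto].
Qed.

Lemma provable_raa T p : provable (tadd T (Imp p Bot)) Bot -> provable T p.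
Proof.
  intros H; apply provable_deduction in H; eapply provable_nd with [Imp (Imp p Bot) Bot].
  - intros q [<-|[]]; auto.
  - apply nd_raa; eapply nd_impE; apply nd_hyp; simpl; auto.
Qed.

Fixpoint code (p : form) : nat :=
  match p with
  | Bot => to_nat (0, 0)
  | Eq i j => to_nat (1, to_nat (i, j))
  | Mem i j => to_nat (2, to_nat (i, j))
  | Imp p q => to_nat (3, to_nat (code p, code q))
  | All p => to_nat (4, code p)
  end.

Lemma code_inj p q : code p = code q -> p = q.
Proof.
  revert q; induction p; intros [] H; unfold code in H; fold code in H;
    apply to_nat_inj, pair_equal_spec in H as [H1 H]; try discriminate H1; auto;
    try (apply to_nat_inj, pair_equal_spec in H as [H H']); f_equal; auto.
Qed.

(** On numbers that code no formula the value is arbitrary, which is harmless: the enumeration only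
    has to meet each [p] at [code p]. *)
Definition decode (n : nat) : form := epsilon (inhabits Bot) (fun p => code p = n).

Lemma decode_code p : decode (code p) = p.
Proof.
  apply code_inj; unfold decode.
  apply (epsilon_spec (inhabits Bot) (fun q => code q = code p)); eauto.
Qed.

(** * Satisfaction *)

Definition ext {M : Type} (m : M) (env : nat -> M) (i : nat) : M :=
  match i with 0 => m | S j => env j end.

Fixpoint sat {M : Type} (E : M -> M -> Prop) (env : nat -> M) (p : form) : Prop :=
  match p with
  | Bot => False
  | Eq i j => env i = env j
  | Mem i j => E (env i) (env j)
  | Imp p q => sat E env p -> sat E env q
  | All p => forall m, sat E (ext m env) p
  end.

Lemma sat_ext_free {M} (E : M -> M -> Prop) env env' p :
  (forall i, free i p -> env i = env' i) -> sat E env p <-> sat E env' p.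
Proof.
  revert env env'; induction p; intros env env' H; simpl in *.
  - tauto.
  - rewrite !H by auto; tauto.
  - rewrite !H by auto; tauto.
  - rewrite IHp1, IHp2; [reflexivity|auto|auto].
  - assert (forall m, sat E (ext m env) p <-> sat E (ext m env') p) as H'.
    { intros m; apply IHp; intros [|i] Hi; simpl; auto. }
    split; intros Hs m; apply H', Hs.
Qed.

Lemma sat_ext {M} (E : M -> M -> Prop) env env' p :
  (forall i, env i = env' i) -> sat E env p <-> sat E env' p.
Proof. intros H; apply sat_ext_free; auto. Qed.

Lemma sat_ren {M} (E : M -> M -> Prop) env r p :
  sat E env (ren r p) <-> sat E (fun i => env (r i)) p.
Proof.
  revert env r; induction p; intros env r; simpl.
  - tauto.
  - tauto.
  - tauto.
  - rewrite IHp1, IHp2; reflexivity.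
  - assert (forall m, sat E (ext m env) (ren (up r) p) <->
      sat E (ext m (fun i => env (r i))) p) as H.
    { intros m; rewrite IHp; apply sat_ext; intros [|i]; reflexivity. }
    split; intros Hs m; apply H, Hs.
Qed.

(** * Completeness *)

Section Henkin.
Context (T0 : theory) (T0_consistent : consistent T0).
Context (T0_odd : forall p k, T0 p -> ~ free (2 * k + 1) p).

Definition tapp (A : list form) : theory := fun p => T0 p \/ In p A.

(** Odd variables are free in no formula of [T0], and the finite list [A] has its free variables
    below some [k]; so [2 * k + 1] avoids both. *)
Lemma fresh_exists A : exists c, forall q, tapp A q -> ~ free c q.
Proof.
  assert (exists k, forall q i, In q A -> free i q -> i < k) as [k Hk].
  { clear; induction A as [|p A [k Hk]]; [exists 0; intros q i []|].
    destruct (free_bound p) as [l Hl]; exists (k + l); intros q i [<-|Hq] Hi.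
    - apply Hl in Hi; lia.
    - apply (Hk _ _ Hq) in Hi; lia. }
  exists (2 * k + 1); intros q [Hq|Hq] Hf; [eapply T0_odd; eauto|].
  apply (Hk _ _ Hq) in Hf; lia.
Qed.

Definition fresh (A : list form) : nat :=
  epsilon (inhabits 0) (fun c => forall q, tapp A q -> ~ free c q).

Lemma fresh_spec A q : tapp A q -> ~ free (fresh A) q.
Proof.
  apply (epsilon_spec (inhabits 0) (fun c => forall q, tapp A q -> ~ free c q)),
    fresh_exists.
Qed.

(** Lindenbaum's and Henkin's extensions in one step: a negated universal formula that can be added
    consistently enters together with a counterexample at a fresh variable. One shape suffices since
    [All] is the only primitive quantifier. *)
Definition henkin_step (p : form) (A : list form) : list form :=
  if excluded_middle_informative (consistent (tapp (p :: A)))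
  then match p with
       | Imp (All q) Bot => Imp (subst0 (fresh (p :: A)) q) Bot :: p :: A
       | _ => p :: A
       end
  else A.

Lemma henkin_step_incl p A : incl A (henkin_step p A).
Proof.
  intros q Hq; unfold henkin_step; destruct excluded_middle_informative; auto.
  destruct p as [| | |[| | | |p] []|]; simpl; auto.
Qed.

Lemma henkin_step_in p A : consistent (tapp (p :: A)) -> In p (henkin_step p A).
Proof.
  intros H; unfold henkin_step; destruct excluded_middle_informative; [|tauto].
  destruct p as [| | |[| | | |p] []|]; simpl; auto.
Qed.

(** If the counterexample caused a contradiction, [A'] would prove the instance of [p] at the fresh
    variable, hence [All p] by generalization, against the negation that [A'] contains. *)
Lemma henkin_step_consistent p A :
  consistent (tapp A) -> consistent (tapp (henkin_step p A)).
Proof.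
  intros HA; unfold henkin_step; destruct excluded_middle_informative as [H|]; auto.
  destruct p as [| | |[| | | |p] []|]; auto.
  set (A' := Imp (All p) Bot :: A) in *; intros Hbot; apply H.
  assert (provable (tapp A') (subst0 (fresh A') p)) as (G & HG & Hnd).
  { apply provable_raa; eapply provable_mono; [exact Hbot|].
    intros q [Hq|[<-|Hq]]; [left; left | right | left; right]; auto. }
  apply provable_mp with (All p).
  - apply provable_hyp; right; left; reflexivity.
  - exists G; split; auto; apply nd_generalize with (fresh A'); auto.
    + intros q Hq; apply fresh_spec; auto.
    + pose proof (fresh_spec A' (Imp (All p) Bot)) as Hf; simpl in *.
      intros Hp; apply Hf; [right; left; reflexivity|auto].
Qed.

Fixpoint stage (n : nat) : list form :=
  match n with 0 => [] | S m => henkin_step (decode m) (stage m) end.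

Lemma stage_incl n m : n <= m -> incl (stage n) (stage m).
Proof.
  induction 1; [apply incl_refl|].
  eapply incl_tran; [eassumption|apply henkin_step_incl].
Qed.

Lemma stage_consistent n : consistent (tapp (stage n)).
Proof.
  induction n; simpl; [|apply henkin_step_consistent; auto].
  intros H; apply T0_consistent; eapply provable_mono; [exact H|].
  intros q [Hq|[]]; auto.
Qed.

Definition omega : theory := fun p => exists n, tapp (stage n) p.

Lemma omega_consistent : consistent omega.
Proof.
  intros (G & HG & H).
  assert (exists n, forall q, In q G -> tapp (stage n) q) as [n Hn].
  { clear H; induction G as [|g G IH]; [exists 0; intros q []|].
    destruct IH as [n Hn]; [intros q Hq; apply HG; simpl; auto|].
    destruct (HG g (or_introl eq_refl)) as [m Hm].
    assert (forall k l q, k <= l -> tapp (stage k) q -> tapp (stage l) q) as Hmon.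
    { intros k l q Hkl [Hq|Hq]; [left|right; eapply stage_incl]; eauto. }
    exists (n + m); intros q [<-|Hq].
    - apply Hmon with m; auto; lia.
    - apply Hmon with n; auto; lia. }
  apply (stage_consistent n); exists G; split; auto.
Qed.

Lemma stage_code p : stage (S (code p)) = henkin_step p (stage (code p)).
Proof. now cbn [stage]; rewrite decode_code. Qed.

(** When [p] is examined it is tested only against a finite stage over [T0], which is part of
    [omega]; so consistency with all of [omega] forces acceptance. *)
Lemma omega_stage p : consistent (tadd omega p) ->
  In p (stage (S (code p))) /\ consistent (tapp (p :: stage (code p))).
Proof.
  intros H; assert (consistent (tapp (p :: stage (code p)))) as Hc.
  { intros H'; apply H; eapply provable_mono; [exact H'|].
    intros q [Hq|[<-|Hq]]; [left|right|left]; auto; exists (code p); [left|right]; auto. }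
  split; auto; rewrite stage_code; apply henkin_step_in; auto.
Qed.

Lemma omega_max p : consistent (tadd omega p) -> omega p.
Proof. intros H; apply omega_stage in H as [H _]; eexists; right; eauto. Qed.

Lemma omega_closed p : provable omega p -> omega p.
Proof.
  intros H; apply omega_max; intros H'; apply omega_consistent.
  apply provable_mp with p; auto; apply provable_deduction; auto.
Qed.

Lemma omega_nd G p : (forall q, In q G -> omega q) -> nd G p -> omega p.
Proof.
  intros HG H; apply omega_closed; exists G; auto.
Qed.

Lemma omega_not p : ~ omega p -> omega (Imp p Bot).
Proof.
  intros H; apply omega_closed, provable_deduction, NNPP; intros H'.
  apply H, omega_max, H'.
Qed.

Lemma omega_bot : ~ omega Bot.
Proof. intros H; apply omega_consistent, provable_hyp, H. Qed.

Lemma omega_imp p q : omega (Imp p q) <-> (omega p -> omega q).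
Proof.
  split.
  - intros H Hp; apply omega_nd with [Imp p q; p].
    + intros x [<-|[<-|[]]]; auto.
    + eapply nd_impE; apply nd_hyp; simpl; auto.
  - intros H; destruct (classic (omega p)) as [Hp|Hp].
    + apply omega_nd with [q]; [intros x [<-|[]]; auto|].
      apply nd_impI, nd_hyp; simpl; auto.
    + apply omega_not in Hp; apply omega_nd with [Imp p Bot]; [intros x [<-|[]]; auto|].
      apply nd_impI, nd_raa; eapply nd_impE; apply nd_hyp; simpl; auto.
Qed.

Lemma omega_all p : omega (All p) <-> forall t, omega (subst0 t p).
Proof.
  split.
  - intros H t; apply omega_nd with [All p]; [intros x [<-|[]]; auto|].
    apply nd_allE, nd_hyp; simpl; auto.
  - intros H; apply NNPP; intros Hn; apply omega_not in Hn.
    set (q := Imp (All p) Bot) in *.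
    assert (consistent (tadd omega q)) as Hc.
    { intros Hb; apply omega_consistent; eapply provable_mono; [exact Hb|].
      intros x [Hx| ->]; auto. }
    apply omega_stage in Hc as [_ Hc].
    (* The negation [q] was accepted at its own step, which also added a counterexample; this
       contradicts [H] at the fresh variable. *)
    assert (omega (Imp (subst0 (fresh (q :: stage (code q))) p) Bot)) as Hw.
    { exists (S (code q)); right; rewrite stage_code; unfold henkin_step.
      destruct excluded_middle_informative; [left; reflexivity|tauto]. }
    rewrite omega_imp in Hw; apply omega_bot, Hw, H.
Qed.

(** * Equality and the term model *)

Lemma omega_refl i : omega (Eq i i).
Proof. apply omega_nd with []; [intros x []|apply nd_eqI]. Qed.

Lemma omega_subst i j p : omega (Eq i j) -> omega (subst0 i p) -> omega (subst0 j p).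
Proof.
  intros H1 H2; apply omega_nd with [Eq i j; subst0 i p].
  - intros x [<-|[<-|[]]]; auto.
  - eapply nd_eqE; apply nd_hyp; simpl; auto.
Qed.

Lemma omega_sym i j : omega (Eq i j) -> omega (Eq j i).
Proof. intros H; apply (omega_subst i j (Eq 0 (S i)) H), omega_refl. Qed.

Lemma omega_trans i j k : omega (Eq i j) -> omega (Eq j k) -> omega (Eq i k).
Proof. intros H1 H2; apply (omega_subst j k (Eq (S i) 0) H2), H1. Qed.

Lemma omega_mem i j k l :
  omega (Eq i k) -> omega (Eq j l) -> omega (Mem i j) -> omega (Mem k l).
Proof.
  intros H1 H2 H; apply (omega_subst j l (Mem (S k) 0) H2).
  apply (omega_subst i k (Mem 0 (S j)) H1), H.
Qed.

(** [sat] reads [Eq] as equality in Rocq, so variables must be divided by the equality that [omega]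
    asserts; a class is represented by its predicate of members. *)
Definition tclass : Type := { P : nat -> Prop | exists i, P = fun j => omega (Eq i j) }.

Definition cls (i : nat) : tclass :=
  exist _ (fun j => omega (Eq i j)) (ex_intro _ i eq_refl).

Definition tmem (x y : tclass) : Prop :=
  exists i j, x = cls i /\ y = cls j /\ omega (Mem i j).

Lemma cls_surj x : exists i, x = cls i.
Proof.
  destruct x as [P [i ->]]; exists i; unfold cls; f_equal; apply proof_irrelevance.
Qed.

Lemma cls_eq i j : cls i = cls j <-> omega (Eq i j).
Proof.
  split; intros H.
  - injection H as H; apply (f_equal (fun P => P j)) in H; rewrite H; apply omega_refl.
  - assert ((fun k => omega (Eq i k)) = (fun k => omega (Eq j k))) as HP.
    { apply functional_extensionality; intros k; apply propositional_extensionality.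
      split; apply omega_trans; auto; apply omega_sym; auto. }
    unfold cls; apply eq_sig_hprop; [intros P; apply proof_irrelevance|exact HP].
Qed.

(** The renaming [s] is arbitrary so that, under a quantifier, the bound variable can be sent to any
    [t]. Every element is the class of a variable, so the quantifier case is [omega_all]. *)
Lemma truth p s : sat tmem (fun i => cls (s i)) p <-> omega (ren s p).
Proof.
  revert s; induction p; intros s; simpl.
  - pose proof omega_bot; tauto.
  - apply cls_eq.
  - split; intros H; [|exists (s n), (s n0); auto].
    destruct H as (i & j & Hi & Hj & H); apply cls_eq in Hi, Hj.
    eapply omega_mem; [apply omega_sym, Hi|apply omega_sym, Hj|exact H].
  - rewrite IHp1, IHp2, omega_imp; reflexivity.
  - rewrite omega_all.
    assert (forall t, sat tmem (ext (cls t) (fun i => cls (s i))) p <->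
      omega (subst0 t (ren (up s) p))) as H.
    { intros t; transitivity (sat tmem (fun i => cls (ext t s i)) p).
      - apply sat_ext; intros [|i]; reflexivity.
      - rewrite IHp; unfold subst0; rewrite ren_ren.
        erewrite ren_ext; [reflexivity|]; intros [|i]; reflexivity. }
    split; intros Hs.
    + intros t; apply H, Hs.
    + intros m; destruct (cls_surj m) as [t ->]; apply H, Hs.
Qed.

End Henkin.

(* Renaming the variable i to 2 i leaves the odd variables free for use as
   Henkin witnesses, so that T need not consist of sentences. *)
Theorem completeness (T : theory) (p : form) :
  (forall (M : Type) (E : M -> M -> Prop) (env : nat -> M),
    (forall q, T q -> sat E env q) -> sat E env p) ->
  provable T p.
Proof.
  intros H; apply NNPP; intros Hp.
  set (dbl := fun i => 2 * i).
  set (T0 := fun q => exists q', q = ren dbl q' /\ tadd T (Imp p Bot) q').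
  assert (consistent T0) as Hc.
  { intros (G & HG & Hnd); apply Hp, provable_raa.
    exists (map (ren Nat.div2) G); split.
    - intros q Hq; apply in_map_iff in Hq as (q' & <- & Hq').
      apply HG in Hq' as (q'' & -> & Hq''); rewrite ren_ren.
      rewrite (ren_ext _ (fun i => i)), ren_id; auto.
      intros i; apply Nat.div2_double.
    - apply (nd_ren _ _ Nat.div2) in Hnd; exact Hnd. }
  assert (forall q k, T0 q -> ~ free (2 * k + 1) q) as Hodd.
  { intros q k (q' & -> & _) Hf; apply free_ren in Hf as (j & _ & Hj); unfold dbl in Hj; lia. }
  assert (forall q, tadd T (Imp p Bot) q ->
    sat (tmem T0) (fun i => cls T0 (dbl i)) q) as Hsat.
  { intros q Hq; apply truth; auto; exists 0; left; exists q; auto. }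
  apply (Hsat (Imp p Bot)); [right; reflexivity|].
  apply H; intros q Hq; apply Hsat; left; exact Hq.
Qed.

(** * Semantics of the set-theoretic vocabulary *)

Section Model.
Context {M : Type} (E : M -> M -> Prop).
Local Notation "x ∈ y" := (E x y).

(** This and the following predicates copy the formulas of the object language clause by clause,
    bounded quantifiers included, so that [reify] can match the two by shape alone. *)
Definition subset (a b : M) := forall x, x ∈ a -> x ∈ b.
Definition empty (a : M) := forall x, ~ x ∈ a.
Definition nonempty (a : M) := exists x, x ∈ a.
Definition is_powerset (p a : M) := forall x, x ∈ p <-> subset x a.
Definition is_union (u a : M) := forall x, x ∈ u <-> exists y, y ∈ a /\ x ∈ y.
Definition is_inter (w u v : M) := forall x, x ∈ w <-> x ∈ u /\ x ∈ v.
Definition is_pair (p x y : M) := forall z, z ∈ p <-> z = x \/ z = y.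
Definition is_opair (p x y : M) :=
  exists u v, is_pair u x x /\ is_pair v x y /\ is_pair p u v.
Definition is_product (c a b : M) :=
  forall p, p ∈ c <-> exists x, x ∈ a /\ exists y, y ∈ b /\ is_opair p x y.
Definition app (f x y : M) := exists p, p ∈ f /\ is_opair p x y.
Definition app2 (f x y z : M) := exists p, is_opair p x y /\ app f p z.
Definition is_rel (r a b : M) :=
  forall p, p ∈ r -> exists x, x ∈ a /\ exists y, y ∈ b /\ is_opair p x y.
Definition ex1 (P : M -> Prop) := exists x, P x /\ forall y, P y -> y = x.
Definition is_fun (f a b : M) :=
  is_rel f a b /\ forall x, x ∈ a -> ex1 (fun y => app f x y).
Definition is_fun2 (f a b c : M) := exists q, is_product q a b /\ is_fun f q c.
Definition is_bij (f a b : M) :=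
  is_fun f a b /\ forall y, y ∈ b -> ex1 (fun x => app f x y).
Definition is_funset (e a b : M) := forall f, f ∈ e <-> is_fun f a b.
Definition is_succ (s n : M) := forall z, z ∈ s <-> z ∈ n \/ z = n.
Definition inductive (w : M) :=
  (exists e, e ∈ w /\ empty e) /\
  forall n, n ∈ w -> exists s, s ∈ w /\ is_succ s n.
Definition is_nat (n : M) := forall w, inductive w -> n ∈ w.
Definition finite (a : M) := exists n f, is_nat n /\ is_bij f a n.
Definition is_two (t : M) := exists z o, empty z /\ is_succ o z /\ is_pair t z o.

Definition is_field (K add mul zero one : M) :=
  is_fun2 add K K K /\ is_fun2 mul K K K /\ zero ∈ K /\ one ∈ K /\ ~ zero = one /\
  (forall x, x ∈ K -> forall y, y ∈ K -> forall s, s ∈ K ->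
     app2 add x y s -> app2 add y x s) /\
  (forall x, x ∈ K -> forall y, y ∈ K -> forall z, z ∈ K ->
   forall u, u ∈ K -> forall v, v ∈ K -> forall s, s ∈ K ->
     app2 add x y u /\ app2 add y z v /\ app2 add u z s -> app2 add x v s) /\
  (forall x, x ∈ K -> app2 add x zero x) /\
  (forall x, x ∈ K -> exists y, y ∈ K /\ app2 add x y zero) /\
  (forall x, x ∈ K -> forall y, y ∈ K -> forall s, s ∈ K ->
     app2 mul x y s -> app2 mul y x s) /\
  (forall x, x ∈ K -> forall y, y ∈ K -> forall z, z ∈ K ->
   forall u, u ∈ K -> forall v, v ∈ K -> forall s, s ∈ K ->
     app2 mul x y u /\ app2 mul y z v /\ app2 mul u z s -> app2 mul x v s) /\
  (forall x, x ∈ K -> app2 mul x one x) /\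
  (forall x, x ∈ K -> ~ x = zero -> exists y, y ∈ K /\ app2 mul x y one) /\
  (forall x, x ∈ K -> forall y, y ∈ K -> forall z, z ∈ K -> forall s, s ∈ K ->
   forall u, u ∈ K -> forall v, v ∈ K -> forall t, t ∈ K ->
     app2 add y z s /\ app2 mul x y u /\ app2 mul x z v /\ app2 add u v t ->
     app2 mul x s t).

Definition is_ordered_field (K add mul lt zero one : M) :=
  is_field K add mul zero one /\
  is_rel lt K K /\
  (forall x, x ∈ K -> ~ app lt x x) /\
  (forall x, x ∈ K -> forall y, y ∈ K -> forall z, z ∈ K ->
     app lt x y /\ app lt y z -> app lt x z) /\
  (forall x, x ∈ K -> forall y, y ∈ K -> app lt x y \/ x = y \/ app lt y x) /\
  (forall x, x ∈ K -> forall y, y ∈ K -> forall z, z ∈ K ->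
   forall u, u ∈ K -> forall v, v ∈ K ->
     app lt x y /\ app2 add x z u /\ app2 add y z v -> app lt u v) /\
  (forall x, x ∈ K -> forall y, y ∈ K -> forall u, u ∈ K ->
     app lt zero x /\ app lt zero y /\ app2 mul x y u -> app lt zero u).

Definition is_upper_bound (K lt s b : M) :=
  b ∈ K /\ forall x, x ∈ s -> ~ app lt b x.

Definition is_reals (K add mul lt zero one : M) :=
  is_ordered_field K add mul lt zero one /\
  forall s, subset s K /\ nonempty s /\ (exists b, is_upper_bound K lt s b) ->
    exists l, is_upper_bound K lt s l /\
      forall b, is_upper_bound K lt s b -> ~ app lt b l.

Definition is_topology (T C : M) :=
  (forall u, u ∈ T -> subset u C) /\
  C ∈ T /\
  (forall F u, subset F T /\ is_union u F -> u ∈ T) /\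
  (forall u, u ∈ T -> forall v, v ∈ T -> forall w, is_inter w u v -> w ∈ T).

Definition is_metric (d C K add lt zero : M) :=
  is_fun2 d C C K /\
  (forall x, x ∈ C -> forall y, y ∈ C -> forall r, r ∈ K ->
     app2 d x y r -> ~ app lt r zero) /\
  (forall x, x ∈ C -> forall y, y ∈ C -> (app2 d x y zero <-> x = y)) /\
  (forall x, x ∈ C -> forall y, y ∈ C -> forall r, r ∈ K ->
     app2 d x y r -> app2 d y x r) /\
  (forall x, x ∈ C -> forall y, y ∈ C -> forall z, z ∈ C ->
   forall r, r ∈ K -> forall s, s ∈ K -> forall t, t ∈ K -> forall u, u ∈ K ->
     app2 d x y r /\ app2 d y z s /\ app2 d x z t /\ app2 add r s u ->
     ~ app lt u t).

Definition is_ball (b x e d C lt : M) :=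
  forall y, y ∈ b <-> y ∈ C /\ exists r, app2 d x y r /\ app lt r e.

Definition metric_induces (d C K lt zero T : M) :=
  forall u, u ∈ T <-> subset u C /\
    forall x, x ∈ u -> exists e, e ∈ K /\ app lt zero e /\
      exists b, is_ball b x e d C lt /\ subset b u.

Definition metrizable (C T : M) :=
  exists K add mul lt zero one, is_reals K add mul lt zero one /\
    exists d, is_metric d C K add lt zero /\ metric_induces d C K lt zero T.

Definition open_cover (U C T : M) :=
  subset U T /\ forall x, x ∈ C -> exists u, u ∈ U /\ x ∈ u.
Definition refines (V U : M) :=
  forall v, v ∈ V -> exists u, u ∈ U /\ subset v u.
Definition neighborhood (N x C T : M) :=
  subset N C /\ exists u, u ∈ T /\ x ∈ u /\ subset u N.
Definition locally_finite (V C T : M) :=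
  forall x, x ∈ C -> exists N, neighborhood N x C T /\
    exists L, (forall v, v ∈ L <-> v ∈ V /\ exists y, y ∈ v /\ y ∈ N) /\ finite L.
Definition paracompact (C T : M) :=
  forall U, open_cover U C T ->
    exists V, open_cover V C T /\ refines V U /\ locally_finite V C T.

Definition is_cylinder (b x v C : M) :=
  forall f, f ∈ b <-> f ∈ C /\ exists y, y ∈ v /\ app f x y.
Definition projections_continuous (T C X S : M) :=
  forall x, x ∈ X -> forall v, v ∈ S -> forall b, is_cylinder b x v C -> b ∈ T.
Definition is_tychonoff (T C X S : M) :=
  is_topology T C /\ projections_continuous T C X S /\
  forall T', is_topology T' C /\ projections_continuous T' C X S -> subset T T'.
Definition is_cantor_cube (C T X : M) :=
  exists two S, is_two two /\ is_powerset S two /\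
    is_funset C X two /\ is_tychonoff T C X S.

(** * Definable predicates *)

Lemma sat_imp env p q P Q :
  (sat E env p <-> P) -> (sat E env q <-> Q) -> (sat E env (Imp p q) <-> (P -> Q)).
Proof. simpl; tauto. Qed.

Lemma sat_not env p P :
  (sat E env p <-> P) -> (sat E env (Imp p Bot) <-> ~ P).
Proof. simpl; tauto. Qed.

Lemma sat_and env p q P Q : (sat E env p <-> P) -> (sat E env q <-> Q) ->
  (sat E env (Imp (Imp p (Imp q Bot)) Bot) <-> P /\ Q).
Proof. simpl; tauto. Qed.

Lemma sat_or env p q P Q : (sat E env p <-> P) -> (sat E env q <-> Q) ->
  (sat E env (Imp (Imp p Bot) q) <-> P \/ Q).
Proof. simpl; tauto. Qed.

Lemma sat_iff env p q P Q : (sat E env p <-> P) -> (sat E env q <-> Q) ->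
  (sat E env (Imp (Imp (Imp p q) (Imp (Imp q p) Bot)) Bot) <-> (P <-> Q)).
Proof. simpl; tauto. Qed.

Lemma sat_all env p (P : M -> Prop) :
  (forall m, sat E (ext m env) p <-> P m) ->
  (sat E env (All p) <-> forall m, P m).
Proof. intros H; split; intros Hs m; apply H, Hs. Qed.

Lemma sat_ex env p (P : M -> Prop) :
  (forall m, sat E (ext m env) p <-> P m) ->
  (sat E env (Imp (All (Imp p Bot)) Bot) <-> exists m, P m).
Proof.
  intros H; simpl; split.
  - intros Hs; apply NNPP; intros Hn; apply Hs; intros m Hm; apply Hn.
    exists m; apply H, Hm.
  - intros [m Hm] Hs; apply (Hs m), H, Hm.
Qed.

Lemma sat_mem env i j : sat E env (Mem i j) <-> env i ∈ env j.
Proof. reflexivity. Qed.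

Lemma sat_eq env i j : sat E env (Eq i j) <-> env i = env j.
Proof. reflexivity. Qed.

Lemma sat_elim env p P : (sat E env p <-> P) -> sat E env p -> P.
Proof. tauto. Qed.

(* The formula is allowed parameters, namely the values of [env]. *)
Definition definable (P : M -> Prop) : Prop :=
  exists p env, forall x, sat E (ext x env) p <-> P x.

Ltac env_index env m :=
  lazymatch env with
  | ext m _ => constr:(0)
  | ext _ ?env' => let i := env_index env' m in constr:(S i)
  end.

Ltac head_of t := lazymatch t with ?f _ => head_of f | _ => t end.

(* Proves [sat E env p <-> P] by recursion on [P]; [p] may be an existential
   variable, which is then instantiated. *)
Ltac reify :=
  lazymatch goal with
  | |- sat ?E ?env ?p <-> ?P =>
    lazymatch P with
    | _ /\ _ => apply sat_and; reify
    | _ \/ _ => apply sat_or; reify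
    | ~ _ => apply sat_not; reify
    | _ <-> _ => apply sat_iff; reify
    | ex1 ?Q => unfold ex1; reify
    | exists m, _ => apply sat_ex; let m' := fresh m in intros m'; cbv beta; reify
    | E ?a ?b =>
      tryif is_evar p then
        let i := env_index env a in let j := env_index env b in exact (sat_mem env i j)
      else exact (iff_refl _)
    | ?a = ?b =>
      tryif is_evar p then
        let i := env_index env a in let j := env_index env b in exact (sat_eq env i j)
      else exact (iff_refl _)
    | ?A -> ?B => apply sat_imp; reify
    | forall m, _ => apply sat_all; let m' := fresh m in intros m'; cbv beta; reify
    | _ => let h := head_of P in unfold h; reify
    end
  end.

Ltac context_env M env :=
  match goal with
  | m : M |- _ =>
    lazymatch env with context [m] => fail | _ => context_env M constr:(ext m env) end
  | _ => env
  end.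

(** All elements of [M] in the context become parameters: they are stacked into the environment, and
    the formula, left as an existential variable, is synthesized by [reify]. *)
Ltac definability :=
  lazymatch goal with
  | |- definable ?P =>
    lazymatch goal with
    | m : M |- _ =>
      let env := context_env M constr:(ext m (fun _ : nat => m)) in
      unfold definable; eexists; exists env;
      let x := fresh "x" in intros x; cbv beta; reify
    end
  end.

(** Evaluation first turns the levels into concrete de Bruijn indices, after which both sides have
    the same shape. *)
Ltac reify_sentence :=
  match goal with
  | |- sat _ _ ?p <-> _ => let p' := eval vm_compute in p in change p with p'
  end;
  reify.

Lemma sat_theorem env :
  sat E env (sentence
    (∀ X C T, Nonempty X ∧ IsCantorCube C T X ∧ Metrizable C T ⇒
      Paracompact C T)%fml) <->
  forall X C T, nonempty X /\ is_cantor_cube C T X /\ metrizable C T -> paracompact C T.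
Proof. reify_sentence. Qed.

(** * Set theory in a model of ZF *)

Context (env0 : nat -> M) (HZF : forall q, ZF q -> sat E env0 q).

Lemma extensionality a b : (forall x, x ∈ a <-> x ∈ b) -> a = b.
Proof.
  enough (forall a b, (forall x, x ∈ a <-> x ∈ b) -> a = b) by auto.
  refine (sat_elim _ _ _ _ (HZF _ ZF_extensionality)); reify_sentence.
Qed.

Lemma pairing x y : exists p, is_pair p x y.
Proof.
  enough (forall x y, exists p, is_pair p x y) by auto.
  refine (sat_elim _ _ _ _ (HZF _ ZF_pairing)); reify_sentence.
Qed.

Lemma union a : exists u, is_union u a.
Proof.
  enough (forall a, exists u, is_union u a) by auto.
  refine (sat_elim _ _ _ _ (HZF _ ZF_union)); reify_sentence.
Qed.

Lemma powerset a : exists p, is_powerset p a.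
Proof.
  enough (forall a, exists p, is_powerset p a) by auto.
  refine (sat_elim _ _ _ _ (HZF _ ZF_powerset)); reify_sentence.
Qed.

(** The last entry is bound innermost and gets index 0, so entry [i] sits at [length l - S i]: the
    same passage from levels to indices as in the atoms of [fml]. *)
Definition push (l : list M) (env : nat -> M) : nat -> M :=
  fold_left (fun e m => ext m e) l env.

Lemma push_nth l env i m :
  i < length l -> push l env (length l - S i) = nth i l m.
Proof.
  assert (forall l env j, push l env (length l + j) = env j) as Hlen.
  { induction l0 as [|a l0 IH]; intros e j; simpl; auto.
    replace (S (length l0 + j)) with (length l0 + S j) by lia; apply (IH (ext a e) (S j)). }
  revert env i; induction l as [|a l IH]; simpl; intros env i Hi; [lia|].
  destruct i as [|i]; simpl.
  - rewrite Nat.sub_0_r. replace (length l) with (length l + 0) at 1 by lia.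
    apply (Hlen l (ext a env) 0).
  - apply IH; lia.
Qed.

Lemma sat_falls n (p : list var -> fml) env d l :
  length l = n -> sat E env (falls n p d) ->
  sat E (push l env) (p (seq d n) (n + d)).
Proof.
  revert p env d l; induction n as [|n IH]; intros p env d [|a l] Hl H; try discriminate Hl.
  - exact H.
  - replace (S n + d) with (n + S d) by lia.
    apply (IH (fun xs => p (d :: xs)) (ext a env) (S d) l); auto.
Qed.

(** A formula looks at finitely many values of [env] only; these instantiate the leading quantifiers
    of the axiom, and what remains is to match levels with indices. *)
Lemma separation P a : definable P -> exists b, forall x, x ∈ b <-> x ∈ a /\ P x.
Proof.
  intros (p & env & Hp); destruct (free_bound p) as [n Hn].
  assert (fv_below (1 + n) p) as Hfv.
  { apply fv_below_free; intros i Hi; apply Hn in Hi; lia. }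
  pose proof (HZF _ (ZF_separation n p Hfv)) as H.
  set (l := map env (seq 0 n)).
  assert (length l = n) as Hl by (unfold l; rewrite length_map, length_seq; reflexivity).
  apply (sat_falls n _ _ _ l) in H; auto; rewrite Nat.add_0_r in H.
  set (e := push l env0) in *; specialize (H a).
  (* After the [n] parameters, level [n] is [a], level [S n] is the set [b] to be found, and level
     [S (S n)] is its generic element [x]. *)
  change (sat E (ext a e) (Imp (All (Imp (All (fiff (fmem (S (S n)) (S n))
    (fand (fmem (S (S n)) n) (finst p (S (S n) :: seq 0 n))) (S (S (S n))))) Bot)) Bot)) in H.
  refine (sat_elim _ _ _ (sat_ex _ _ _ (fun b => sat_all _ _ _ (fun x => _))) H).
  cbv beta delta [fiff fand fimp fnot fbot fmem].
  replace (S (S (S n)) - S (S (S n))) with 0 by lia.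
  replace (S (S (S n)) - S (S n)) with 1 by lia.
  replace (S (S (S n)) - S n) with 2 by lia.
  apply sat_iff; [reflexivity|]; apply sat_and; [reflexivity|].
  rewrite <- Hp; unfold finst; rewrite sat_ren; apply sat_ext_free.
  intros [|i] Hi.
  - simpl; rewrite Nat.sub_diag; reflexivity.
  - apply Hn in Hi; cbn [nth]; rewrite seq_nth by lia.
    replace (S (S (S n)) - S (0 + i)) with (S (S (n - i))) by lia.
    destruct (n - i) as [|k] eqn:Hk; [lia|]; simpl.
    replace k with (length l - S i) by lia.
    (* The default [env 0] has the form that [map_nth] requires; it is never reached. *)
    unfold e; rewrite (push_nth l env0 i (env 0)) by lia.
    unfold l; rewrite map_nth, seq_nth by lia; reflexivity.
Qed.

Lemma empty_ex : exists e, empty e.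
Proof.
  destruct (separation (fun x => ~ x = x) (env0 0)) as [e He].
  (* [definability] needs some element of [M] in the context to fill the tail of its environment. *)
  - pose (m := env0 0); clearbody m; definability.
  - exists e; intros x Hx; apply He in Hx; tauto.
Qed.

Lemma union2 a b : exists c, forall x, x ∈ c <-> x ∈ a \/ x ∈ b.
Proof.
  destruct (pairing a b) as [p Hp], (union p) as [c Hc]; exists c; intros x.
  rewrite (Hc x); split.
  - intros (y & Hy & Hx); apply Hp in Hy as [-> | ->]; auto.
  - intros [Hx|Hx]; [exists a|exists b]; split; auto; apply Hp; auto.
Qed.

Definition adjoins (b a x : M) := forall z, z ∈ b <-> z ∈ a \/ z = x.

Lemma adjoin a x : exists b, adjoins b a x.
Proof.
  destruct (pairing x x) as [s Hs], (union2 a s) as [b Hb]; exists b; intros z.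
  rewrite Hb, (Hs z); tauto.
Qed.

(** * Ordered pairs and functions in the model *)

Lemma pair_inj p q x y x' y' : is_pair p x y -> is_pair q x' y' -> p = q ->
  x = x' /\ y = y' \/ x = y' /\ y = x'.
Proof.
  intros H H' <-; pose proof (proj1 (H' x) (proj2 (H x) (or_introl eq_refl))).
  pose proof (proj1 (H' y) (proj2 (H y) (or_intror eq_refl))).
  pose proof (proj1 (H x') (proj2 (H' x') (or_introl eq_refl))).
  pose proof (proj1 (H y') (proj2 (H' y') (or_intror eq_refl))).
  intuition congruence.
Qed.

Lemma opair_inj p x y x' y' : is_opair p x y -> is_opair p x' y' -> x = x' /\ y = y'.
Proof.
  intros (u & v & Hu & Hv & Hp) (u' & v' & Hu' & Hv' & Hp').
  assert (forall s a b c, is_pair s a a -> is_pair s b c -> b = a /\ c = a) as Hs.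
  { intros s a b c H1 H2; destruct (proj1 (H1 b) (proj2 (H2 b) (or_introl eq_refl))),
      (proj1 (H1 c) (proj2 (H2 c) (or_intror eq_refl))); auto. }
  destruct (pair_inj _ _ _ _ _ _ Hp Hp' eq_refl) as [[-> ->]|[-> ->]].
  - destruct (pair_inj _ _ _ _ _ _ Hu Hu' eq_refl) as [[<- _]|[<- _]];
      destruct (pair_inj _ _ _ _ _ _ Hv Hv' eq_refl); intuition congruence.
  - destruct (Hs _ _ _ _ Hu Hv'), (Hs _ _ _ _ Hu' Hv); split; congruence.
Qed.

Lemma opair_ex x y : exists p, is_opair p x y.
Proof.
  destruct (pairing x x) as [u Hu], (pairing x y) as [v Hv], (pairing u v) as [p Hp].
  exists p, u, v; auto.
Qed.

Lemma pair_unique p q x y : is_pair p x y -> is_pair q x y -> p = q.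
Proof. intros H H'; apply extensionality; intros z; rewrite (H z), (H' z); reflexivity. Qed.

Lemma opair_unique p q x y : is_opair p x y -> is_opair q x y -> p = q.
Proof.
  intros (u & v & Hu & Hv & Hp) (u' & v' & Hu' & Hv' & Hp').
  rewrite (pair_unique _ _ _ _ Hu Hu'), (pair_unique _ _ _ _ Hv Hv') in Hp.
  eapply pair_unique; eauto.
Qed.

Lemma app_opair f p x y : is_opair p x y -> app f x y <-> p ∈ f.
Proof.
  intros Hp; split; [|intros H; exists p; auto].
  intros (q & Hq & H); rewrite (opair_unique _ _ _ _ Hp H); exact Hq.
Qed.

Lemma fun_codom f a b x y : is_fun f a b -> app f x y -> x ∈ a /\ y ∈ b.
Proof.
  intros [Hr _] (p & Hp & Hxy); apply Hr in Hp as (x' & Hx & y' & Hy & H).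
  destruct (opair_inj _ _ _ _ _ Hxy H) as [-> ->]; auto.
Qed.

Lemma fun_total f a b x : is_fun f a b -> x ∈ a -> exists y, y ∈ b /\ app f x y.
Proof.
  intros H Hx; destruct (proj2 H x Hx) as (y & Hy & _); exists y; split; auto.
  apply (fun_codom _ _ _ _ _ H Hy).
Qed.

Lemma fun_functional f a b x y y' : is_fun f a b -> app f x y -> app f x y' -> y = y'.
Proof.
  intros H Hy Hy'; destruct (fun_codom _ _ _ _ _ H Hy) as [Hx _].
  destruct (proj2 H x Hx) as (z & _ & Hz); rewrite (Hz y Hy), (Hz y' Hy'); reflexivity.
Qed.

Lemma fun2_total f a b c x y :
  is_fun2 f a b c -> x ∈ a -> y ∈ b -> exists z, z ∈ c /\ app2 f x y z.
Proof.
  intros (q & Hq & Hf) Hx Hy; destruct (opair_ex x y) as [p Hp].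
  destruct (fun_total _ _ _ p Hf) as (z & Hz & H); [apply Hq; eauto|].
  exists z; split; auto; exists p; auto.
Qed.

Lemma fun2_functional f a b c x y z z' :
  is_fun2 f a b c -> app2 f x y z -> app2 f x y z' -> z = z'.
Proof.
  intros (q & Hq & Hf) (p & Hp & Hz) (p' & Hp' & Hz').
  rewrite <- (opair_unique _ _ _ _ Hp Hp') in Hz'; eapply fun_functional; eauto.
Qed.

Lemma fun2_codom f a b c x y z :
  is_fun2 f a b c -> app2 f x y z -> x ∈ a /\ y ∈ b /\ z ∈ c.
Proof.
  intros (q & Hq & Hf) (p & Hp & Hz); destruct (fun_codom _ _ _ _ _ Hf Hz) as [H ?].
  apply Hq in H as (x' & Hx & y' & Hy & H).
  destruct (opair_inj _ _ _ _ _ Hp H) as [-> ->]; auto.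
Qed.

(** Kuratowski pairs over the union of [X] and [two] lie in its double power set, so the graph can
    be obtained by separation. *)
Lemma indicator X two zero one A : is_pair two zero one ->
  exists g, is_fun g X two /\
    forall y v, app g y v <-> y ∈ X /\ (y ∈ A /\ v = one \/ ~ y ∈ A /\ v = zero).
Proof.
  intros Htwo; destruct (union2 X two) as [c Hc], (powerset c) as [c' Hc'],
    (powerset c') as [c'' Hc''].
  destruct (separation (fun p => exists y, y ∈ X /\ ((y ∈ A /\ is_opair p y one)
    \/ (~ y ∈ A /\ is_opair p y zero))) c'') as [g Hg]; [definability|].
  assert (zero ∈ two /\ one ∈ two) as [Hz Ho] by (split; apply Htwo; auto).
  assert (forall y v p, y ∈ X -> v ∈ two -> is_opair p y v -> p ∈ c'') as Hin.
  { intros y v p Hy Hv (u & w & Hu & Hw & Hp); apply Hc''; intros z Hz'.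
    apply Hc'; intros t Ht; apply Hc.
    apply Hp in Hz' as [-> | ->]; [apply Hu in Ht | apply Hw in Ht];
      destruct Ht as [-> | ->]; auto. }
  assert (forall y v, app g y v <->
    y ∈ X /\ (y ∈ A /\ v = one \/ ~ y ∈ A /\ v = zero)) as Happ.
  { intros y v; destruct (opair_ex y v) as [p Hp]; rewrite (app_opair _ _ _ _ Hp), Hg.
    split.
    - intros (_ & y' & Hy & [[HA H]|[HA H]]); destruct (opair_inj _ _ _ _ _ Hp H) as [-> ->];
        auto.
    - intros (Hy & [[HA ->]|[HA ->]]); split; eauto. }
  exists g; split; auto; split.
  - intros p Hp; apply Hg in Hp as (_ & y & Hy & [[_ H]|[_ H]]); exists y; split; eauto.
  - intros y Hy; destruct (classic (y ∈ A)) as [HA|HA].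
    + exists one; split; [apply Happ; auto|intros v Hv; apply Happ in Hv; tauto].
    + exists zero; split; [apply Happ; auto|intros v Hv; apply Happ in Hv; tauto].
Qed.

Lemma singleton_finite L v : (forall z, z ∈ L <-> z = v) -> finite L.
Proof.
  (* Here [n] is the numeral 1, that is {∅}; it lies in every inductive set as the successor of ∅.
     The bijection is the single pair (v, ∅). *)
  intros HL; destruct empty_ex as [e He], (pairing e e) as [n Hn].
  destruct (opair_ex v e) as [p Hp], (pairing p p) as [f Hf].
  assert (forall x y, app f x y <-> x = v /\ y = e) as Happ.
  { intros x y; split.
    - intros (q & Hq & H); apply Hf in Hq as [-> | ->];
        destruct (opair_inj _ _ _ _ _ Hp H); auto.
    - intros [-> ->]; exists p; split; [apply Hf|]; auto. }
  exists n, f; split; [|split; [split|]].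
  - intros w [(e' & Hw & He') Hs].
    assert (e' = e) as -> by (apply extensionality; intros z; split; intros Hz;
      [destruct (He' z Hz)|destruct (He z Hz)]).
    destruct (Hs e Hw) as (s & Hs' & H); replace n with s; auto.
    apply extensionality; intros z; rewrite (H z), (Hn z); pose proof (He z); tauto.
  - intros q Hq; apply Hf in Hq; exists v; split; [apply HL; auto|].
    exists e; split; [apply Hn; auto|]; destruct Hq as [-> | ->]; auto.
  - intros x Hx; apply HL in Hx as ->; exists e; split; [apply Happ; auto|].
    intros y Hy; apply Happ in Hy; tauto.
  - intros y Hy; apply Hn in Hy; exists v; split; [apply Happ; tauto|].
    intros x Hx; apply Happ in Hx; tauto.
Qed.

(** * Kuratowski finite subsets *)

(** Kuratowski's notion of finiteness: the finite subsets of [X] are those lying in every family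
    that contains ∅ and is closed under adjoining a point of [X]. *)
Definition adjoin_closed (X W : M) :=
  (forall e, empty e -> e ∈ W) /\
  forall B, B ∈ W -> forall x, x ∈ X -> forall B', adjoins B' B x -> B' ∈ W.
Definition finite_in (X A : M) :=
  subset A X /\ forall W, adjoin_closed X W -> A ∈ W.

Lemma finite_empty X e : empty e -> finite_in X e.
Proof.
  intros He; split; [intros x Hx; destruct (He x Hx)|]; intros W [H _]; auto.
Qed.

Lemma finite_adjoin X B x B' :
  finite_in X B -> x ∈ X -> adjoins B' B x -> finite_in X B'.
Proof.
  intros [HB HW] Hx H; split.
  - intros z Hz; apply H in Hz as [Hz| ->]; auto.
  - intros W Hc; apply (proj2 Hc B (HW W Hc) x Hx _ H).
Qed.

(** The family of all subsets of [X] with property [P] is closed under adjunction, so the definition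
    of [finite_in] applies to it; [P] must be definable for this family to be a set. *)
Lemma finite_ind X P : definable P ->
  (forall e, empty e -> P e) ->
  (forall B x B', subset B X -> x ∈ X -> adjoins B' B x -> P B -> P B') ->
  forall A, finite_in X A -> P A.
Proof.
  intros HP H0 HS A [_ HA]; destruct (powerset X) as [PX HPX].
  destruct (separation P PX HP) as [W HW]; apply HW, HA; split.
  - intros e He; apply HW; split; auto; apply HPX; intros z Hz; destruct (He z Hz).
  - intros B HB x Hx B' H; apply HW in HB as [HB HPB]; apply HPX in HB.
    apply HW; split; [apply HPX; intros z Hz; apply H in Hz as [Hz| ->]; auto|].
    eapply HS; eauto.
Qed.

Lemma subset_antisym a b : subset a b -> subset b a -> a = b.
Proof. intros H1 H2; apply extensionality; split; auto. Qed.

Lemma finite_union X A B C : finite_in X A -> finite_in X B ->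
  (forall z, z ∈ C <-> z ∈ A \/ z ∈ B) -> finite_in X C.
Proof.
  intros HA HB; revert C; pattern B; apply (finite_ind X); auto.
  - definability.
  - intros e He C HC; replace C with A; auto; apply extensionality; intros z.
    rewrite HC; pose proof (He z); tauto.
  - intros D x D' HD Hx HD' IH C HC; destruct (union2 A D) as [C' HC'].
    apply (finite_adjoin X C' x); auto; intros z; rewrite HC, HC', (HD' z); tauto.
Qed.

Lemma finite_subset X A B : finite_in X A -> subset B A -> finite_in X B.
Proof.
  intros HA; revert B; pattern A; apply (finite_ind X); auto.
  - definability.
  - intros e He B HB; apply finite_empty; intros z Hz; apply (He z); auto.
  - intros D x D' HD Hx HD' IH B HB.
    destruct (separation (fun z => z ∈ D) B) as [B0 HB0]; [definability|].
    assert (finite_in X B0) as H0 by (apply IH; intros z Hz; apply HB0, Hz).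
    destruct (classic (x ∈ B)) as [HxB|HxB].
    + apply (finite_adjoin X B0 x); auto; intros z; rewrite HB0; split.
      * intros Hz; destruct (proj1 (HD' z) (HB z Hz)); auto.
      * intros [[Hz _]| ->]; auto.
    + replace B with B0; auto; apply extensionality; intros z; rewrite HB0.
      split; [tauto|]; intros Hz; split; auto.
      destruct (proj1 (HD' z) (HB z Hz)) as [| ->]; tauto.
Qed.

Definition chain (G : M) :=
  forall a, a ∈ G -> forall b, b ∈ G -> subset a b \/ subset b a.
Definition least (G m : M) := m ∈ G /\ forall b, b ∈ G -> subset m b.

Lemma chain_least X G A : chain G -> finite_in X A -> A ∈ G -> exists m, least G m.
Proof.
  intros HG HA HAG.
  (* By induction on [A]: it suffices that some member of [G] is covered by [A]
     and a common subset [Z] of all members of [G]. *)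
  enough (forall Z, (forall F, F ∈ G -> subset Z F) ->
    (exists F, F ∈ G /\ forall x, x ∈ F -> x ∈ A \/ x ∈ Z) ->
    exists m, least G m) as H.
  { destruct empty_ex as [e He]; apply (H e).
    - intros F _ x Hx; destruct (He x Hx).
    - exists A; auto. }
  clear HAG; pattern A; apply (finite_ind X); auto; clear A HA.
  - definability.
  - intros e He Z HZ (F & HF & H); exists F; split; auto; intros b Hb x Hx.
    apply (HZ b Hb); destruct (H x Hx) as [Hxe|]; auto; destruct (He x Hxe).
  - intros B x B' _ _ HB' IH Z HZ (F & HF & H).
    destruct (classic (forall F, F ∈ G -> x ∈ F)) as [Hx|Hx].
    + destruct (adjoin Z x) as [Z' HZ']; apply (IH Z').
      * intros D HD z Hz; apply HZ' in Hz as [Hz| ->]; [apply (HZ D HD)|apply Hx]; auto.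
      * exists F; split; auto; intros z Hz; rewrite (HZ' z).
        destruct (H z Hz) as [Hz'|Hz']; [apply HB' in Hz'|]; tauto.
    + apply not_all_ex_not in Hx as [D HD]; apply imply_to_and in HD as [HD HxD].
      assert (exists F', F' ∈ G /\ subset F' F /\ ~ x ∈ F') as (F' & HF' & Hs & Hn).
      { destruct (HG D HD F HF) as [Hs|Hs]; [exists D|exists F]; repeat split; auto.
        intros z Hz; auto. }
      apply (IH Z HZ); exists F'; split; auto; intros z Hz.
      destruct (H z (Hs z Hz)) as [Hz'|Hz']; auto.
      apply HB' in Hz' as [| ->]; tauto.
Qed.

(** * Cantor cubes *)

Definition agree (f g A : M) := forall x, x ∈ A -> forall y, app f x y -> app g x y.

(** The one-sided definition is symmetric for functions: [f] has some value at each point of [A],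
    and [g] has only one. *)
Lemma agree_sym X two f g A : is_fun f X two -> is_fun g X two -> subset A X ->
  agree f g A -> agree g f A.
Proof.
  intros Hf Hg HA H x Hx y Hy.
  destruct (fun_total _ _ _ x Hf (HA x Hx)) as (z & _ & Hz).
  rewrite (fun_functional _ _ _ _ _ _ Hg Hy (H x Hx z Hz)); exact Hz.
Qed.

Lemma agree_trans f g h A : agree f g A -> agree g h A -> agree f h A.
Proof. unfold agree; auto. Qed.

Lemma agree_subset f g A B : subset A B -> agree f g B -> agree f g A.
Proof. unfold agree; auto. Qed.

Definition is_box (v f A C : M) := forall g, g ∈ v <-> g ∈ C /\ agree f g A.

Lemma box_ex f A C : exists v, is_box v f A C.
Proof. apply separation; definability. Qed.

Section Cube.
Context (X C T two S zero one : M).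
Context (Hzero : empty zero) (Hone : is_succ one zero) (Htwo : is_pair two zero one)
  (HS : is_powerset S two) (HC : is_funset C X two) (HT : is_tychonoff T C X S).

Lemma zero_neq_one : zero <> one.
Proof. intros H; apply (Hzero zero); rewrite H at 2; apply Hone; auto. Qed.

(** Over ∅ the box is all of [C]; adjoining [x] to the coordinates intersects it with the cylinder
    over the singleton of the value of [f] at [x]. *)
Lemma box_open A f v : finite_in X A -> f ∈ C -> is_box v f A C -> v ∈ T.
Proof.
  intros HA Hf; destruct HT as ((_ & HCT & _ & Hinter) & Hproj & _).
  revert v; pattern A; apply (finite_ind X); auto.
  - definability.
  - intros e He v Hv; replace v with C; auto; apply extensionality; intros g.
    rewrite (Hv g); split; [|tauto]; intros Hg; split; auto.
    intros x Hx; destruct (He x Hx).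
  - intros B x B' HB Hx HB' IH v Hv; destruct (box_ex f B C) as [w Hw].
    destruct (fun_total f X two x) as (y & Hy & Hxy); [apply HC, Hf|exact Hx|].
    destruct (pairing y y) as [s Hs].
    destruct (separation (fun g => exists y, y ∈ s /\ app g x y) C) as [c Hc];
      [definability|].
    apply (Hinter w (IH w Hw) c).
    + apply (Hproj x Hx s); auto; apply HS; intros z Hz.
      apply Hs in Hz as [-> | ->]; auto.
    + intros g; rewrite (Hv g), (Hw g), Hc; split.
      * intros [Hg H]; repeat split; auto.
        -- apply (agree_subset _ _ _ B'); auto; intros z Hz; apply HB'; auto.
        -- exists y; split; [apply Hs; auto|apply H; auto; apply HB'; auto].
      * intros [[Hg H] [_ (y' & Hy' & Hgx)]]; split; auto; intros z Hz t Ht.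
        apply HB' in Hz as [Hz| ->]; [apply H; auto|].
        rewrite (fun_functional f X two x t y); [|apply HC, Hf|exact Ht|exact Hxy].
        apply Hs in Hy' as [-> | ->]; exact Hgx.
Qed.

Definition box_interior (u : M) :=
  forall f, f ∈ u -> exists A, finite_in X A /\ forall g, g ∈ C -> agree f g A -> g ∈ u.

(* The sets satisfying [box_interior] form a topology that makes all projections
   continuous, so by minimality it contains [T]. *)
Lemma open_box_interior u : u ∈ T -> box_interior u.
Proof.
  destruct (powerset C) as [PC HPC].
  destruct (separation box_interior PC) as [T' HT']; [definability|].
  enough (subset T T') as H by (intros Hu; apply H, HT' in Hu; tauto).
  apply HT; split; [split; [|split; [|split]]|].
  - intros v Hv; apply HPC, HT', Hv.
  - apply HT'; split; [apply HPC; intros z Hz; auto|].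
    intros f _; destruct empty_ex as [e He]; exists e; split; auto.
    apply finite_empty; auto.
  - intros F v [HF Hv]; apply HT'; split.
    + apply HPC; intros f Hf; apply Hv in Hf as (w & Hw & Hf).
      apply HF, HT' in Hw as [Hw _]; apply (proj1 (HPC w) Hw f Hf).
    + intros f Hf; apply Hv in Hf as (w & Hw & Hf).
      pose proof (proj2 (proj1 (HT' w) (HF w Hw)) f Hf) as (A & HA & H).
      exists A; split; auto; intros g Hg Hfg; apply Hv; eauto.
  - intros v Hv w Hw t Ht; apply HT' in Hv as [HvC Hv], Hw as [HwC Hw].
    apply HT'; split.
    + apply HPC; intros f Hf; apply Ht in Hf as [Hf _].
      apply (proj1 (HPC v) HvC f Hf).
    + intros f Hf; apply Ht in Hf as [Hfv Hfw].
      destruct (Hv f Hfv) as (A & HA & H), (Hw f Hfw) as (B & HB & H').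
      destruct (union2 A B) as [D HD]; exists D; split; [apply (finite_union X A B); auto|].
      intros g Hg Hfg; apply Ht; split; [apply H|apply H']; auto;
        apply (agree_subset _ _ _ D); auto; intros z Hz; apply HD; auto.
  - intros x Hx v Hv b Hb; apply HT'; split; [apply HPC; intros f Hf; apply Hb, Hf|].
    intros f Hf; apply Hb in Hf as (Hf & y & Hy & Hxy).
    destruct (pairing x x) as [A HA]; exists A; split.
    + destruct empty_ex as [e He]; apply (finite_adjoin X e x); auto.
      * apply finite_empty; auto.
      * intros z; rewrite (HA z); pose proof (He z); tauto.
    + intros g Hg Hfg; apply Hb; split; auto; exists y; split; auto.
      apply Hfg; auto; apply HA; auto.
Qed.

(** * Paracompactness from a cofinal chain of finite sets of coordinates *)

Lemma cofinal_chain_paracompact Fs : chain Fs ->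
  (forall F, F ∈ Fs -> finite_in X F) ->
  (forall A, finite_in X A -> exists F, F ∈ Fs /\ subset A F) ->
  paracompact C T.
Proof.
  intros Hchain Hfin Hcof U [HUT HUC].
  (* [good f F] says that the box of [f] over [F] lies in one member of the cover; [minimal f F]
     then means F = F(f). *)
  set (good := fun f F => exists u, u ∈ U /\ forall g, g ∈ C -> agree f g F -> g ∈ u).
  set (minimal := fun f F => F ∈ Fs /\ good f F /\
    forall F', F' ∈ Fs -> good f F' -> subset F F').
  assert (forall f, f ∈ C -> exists F, minimal f F) as Hmin.
  { intros f Hf; destruct (HUC f Hf) as (u & Hu & Hfu).
    destruct (open_box_interior u (HUT u Hu) f Hfu) as (A & HA & H).
    destruct (Hcof A HA) as (F & HF & HAF).
    destruct (separation (good f) Fs) as [G HG].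
    { unfold good; definability. }
    assert (F ∈ G) as HFG.
    { apply HG; split; auto; exists u; split; auto; intros g Hg Hfg.
      apply H; auto; apply (agree_subset _ _ _ F); auto. }
    destruct (chain_least X G F) as (m & Hm & Hleast); auto.
    - intros a Ha b Hb; apply Hchain; apply HG; auto.
    - apply HG in Hm as [Hm Hgood]; exists m; split; [|split]; auto.
      intros F' HF' Hg; apply Hleast, HG; auto. }
  assert (forall f g F, f ∈ C -> g ∈ C -> F ∈ Fs -> agree f g F -> agree g f F) as Hsym.
  { intros f g F Hf Hg HF; apply (agree_sym X two).
    - apply HC, Hf.
    - apply HC, Hg.
    - apply (Hfin F HF). }
  assert (forall f g F, f ∈ C -> g ∈ C -> minimal f F -> agree f g F -> minimal g F)
    as Htransfer.
  { intros f g F Hf Hg (HF & (u & Hu & Hgood) & Hleast) Hfg; split; [|split]; auto.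
    - exists u; split; auto; intros h Hh Hgh; apply Hgood; auto.
      apply (agree_trans _ g); auto.
    - intros F' HF' (u' & Hu' & Hgood').
      (* In the case where [F'] is contained in [F], [f] and [g] agree on [F'] as well, so [F'] is
         good for [f] too and minimality of [F] applies. *)
      destruct (Hchain F HF F' HF') as [H|H]; auto.
      apply Hleast; auto; exists u'; split; auto; intros h Hh Hfh; apply Hgood'; auto.
      apply (agree_trans _ f); auto; apply Hsym; auto.
      apply (agree_subset _ _ _ F); auto. }
  destruct (powerset C) as [PC HPC].
  (* The boxes are collected as a set, not indexed by points, so equal boxes coincide and no centre
     is selected. *)
  destruct (separation (fun v => exists f, f ∈ C /\ exists F, minimal f F /\
    is_box v f F C) PC) as [V HV].
  { unfold minimal, good; definability. }
  (* A member of [V] is a box around each of its points, just as a ball of an ultrametric space is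
     centred at each of its points. *)
  assert (forall v g, v ∈ V -> g ∈ v -> exists F, minimal g F /\ is_box v g F C) as HVg.
  { intros v g Hv Hg; apply HV in Hv as (_ & f & Hf & F & HF & Hv).
    apply Hv in Hg as [Hg Hfg]; exists F; split; [apply (Htransfer f); auto|].
    intros h; rewrite (Hv h); split; intros [Hh H]; split; auto.
    - apply (agree_trans _ f); auto; apply Hsym; auto; exact (proj1 HF).
    - apply (agree_trans _ g); auto. }
  (* Recentred at the common point [g], both are the box over the unique minimal set of [g]. *)
  assert (forall v w g, v ∈ V -> w ∈ V -> g ∈ v -> g ∈ w -> v = w) as Hdisj.
  { intros v w g Hv Hw Hgv Hgw.
    destruct (HVg v g Hv Hgv) as (F & (HF & HgF & HlF) & Hbv).
    destruct (HVg w g Hw Hgw) as (F' & (HF' & HgF' & HlF') & Hbw).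
    assert (F = F') as <- by (apply subset_antisym; auto).
    apply extensionality; intros h; rewrite (Hbv h), (Hbw h); reflexivity. }
  assert (forall v, v ∈ V -> v ∈ T) as HVT.
  { intros v Hv; apply HV in Hv as (_ & f & Hf & F & (HF & _) & Hv).
    apply (box_open F f); auto. }
  assert (forall f, f ∈ C -> exists v, v ∈ V /\ f ∈ v) as HVC.
  { intros f Hf; destruct (Hmin f Hf) as [F HF], (box_ex f F C) as [v Hv].
    exists v; split; [|apply Hv; split; auto; intros x _ y; auto].
    apply HV; split; [apply HPC; intros g Hg; apply Hv, Hg|eauto]. }
  exists V; split; [split; auto|split].
  - intros v Hv; apply HV in Hv as (_ & f & Hf & F & (_ & (u & Hu & Hgood) & _) & Hv).
    exists u; split; auto; intros g Hg; apply Hv in Hg as [Hg Hfg]; auto.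
  (* The member [v] containing [x] is itself an open neighborhood, and by disjointness it meets no
     other member of [V]. *)
  - intros x Hx; destruct (HVC x Hx) as (v & Hv & Hxv); exists v; split.
    + split; [|exists v; split; auto; split; auto; intros z Hz; auto].
      apply HPC, HV, Hv.
    + destruct (pairing v v) as [L HL]; exists L; split.
      * intros w; rewrite (HL w); split.
        -- intros H; assert (w = v) as -> by tauto; split; auto; exists x; auto.
        -- intros (Hw & y & Hy & Hyv); left; apply (Hdisj w v y); auto.
      * apply (singleton_finite L v); intros z; rewrite (HL z); tauto.
Qed.

(** * The chain of finite sets of coordinates given by a metric *)

Lemma fun_agree_eq f g : f ∈ C -> g ∈ C -> agree f g X -> f = g.
Proof.
  enough (forall f g, f ∈ C -> g ∈ C -> agree f g X -> subset f g) as H.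
  { intros Hf Hg Hfg; apply subset_antisym; apply H; auto.
    apply (agree_sym X two); [apply HC|apply HC|intros x|]; auto. }
  clear f g; intros f g Hf Hg Hfg p Hp.
  destruct (proj1 (proj1 (HC f) Hf) p Hp) as (x & Hx & y & Hy & Hxy).
  apply (app_opair g p x y Hxy), Hfg; auto; apply (app_opair f p x y Hxy), Hp.
Qed.

Section Metric.
Context (K add mul lt kzero kone d : M).
Context (HK : is_ordered_field K add mul lt kzero kone)
  (Hd : is_metric d C K add lt kzero) (Hind : metric_induces d C K lt kzero T).

Lemma lt_trans x y z :
  x ∈ K -> y ∈ K -> z ∈ K -> app lt x y -> app lt y z -> app lt x z.
Proof. intros; apply (proj1 (proj2 (proj2 (proj2 HK))) x) with y; auto. Qed.

Lemma lt_irrefl x : x ∈ K -> ~ app lt x x.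
Proof. apply HK. Qed.

Lemma lt_total x y : x ∈ K -> y ∈ K -> app lt x y \/ x = y \/ app lt y x.
Proof. intros; apply HK; auto. Qed.

Lemma not_lt_trans x y z :
  x ∈ K -> y ∈ K -> z ∈ K -> ~ app lt y x -> ~ app lt z y -> ~ app lt z x.
Proof.
  intros Hx Hy Hz H1 H2 H3; destruct (lt_total y z) as [H|[->|H]]; auto.
  apply H1, (lt_trans y z x); auto.
Qed.

Lemma ball_open x r u : x ∈ C -> r ∈ K -> is_ball u x r d C lt -> u ∈ T.
Proof.
  intros Hx Hr Hu; destruct HK as ((Hadd & _ & HK0 & _ & _ & Hcomm & Hassoc & Hadd0 &
    Hneg & _) & _ & _ & _ & _ & Hmono & _).
  destruct Hd as (Hdf & _ & _ & _ & Htri).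
  apply Hind; split; [intros y Hy; apply Hu, Hy|].
  intros y Hy; apply Hu in Hy as (Hy & s & Hs & Hsr).
  destruct (fun2_codom _ _ _ _ _ _ _ Hdf Hs) as (_ & _ & HsK).
  destruct (Hneg s HsK) as (s' & Hs'K & Hs').
  destruct (fun2_total _ _ _ _ r s' Hadd Hr Hs'K) as (e & He & Hrs).
  (* [e] is r - s with s = d(x, y), where [s'] is the additive inverse of [s]. *)
  exists e; split; [auto|split].
  - apply (Hmono s HsK r Hr s' Hs'K); auto.
  - destruct (separation (fun z => exists t, app2 d y z t /\ app lt t e) C) as [b Hb];
      [definability|].
    exists b; split; [exact Hb|]; intros z Hz; apply Hb in Hz as (Hz & t & Ht & Hte).
    apply Hu; split; auto.
    (* With w = d(x, z), p = s + t and q = e + s, the chain is w ≤ p < q = r. *)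
    destruct (fun2_codom _ _ _ _ _ _ _ Hdf Ht) as (_ & _ & HtK).
    destruct (fun2_total _ _ _ _ x z Hdf Hx Hz) as (w & HwK & Hw).
    destruct (fun2_total _ _ _ _ t s Hadd HtK HsK) as (p & HpK & Hp).
    destruct (fun2_total _ _ _ _ e s Hadd He HsK) as (q & HqK & Hq).
    assert (q = r) as ->.
    { apply (fun2_functional _ _ _ _ r kzero _ _ Hadd); auto.
      apply (Hassoc r Hr s' Hs'K s HsK e He kzero HK0 q HqK); auto. }
    assert (app lt p r) as Hpr
      by (apply (Hmono t HtK e He s HsK p HpK r Hr); auto).
    assert (~ app lt p w) as Hpw
      by (apply (Htri x Hx y Hy z Hz s HsK t HtK w HwK p HpK); auto).
    exists w; split; auto; destruct (lt_total p w) as [H|[->|H]]; auto; [tauto|].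
    apply (lt_trans w p r); auto.
Qed.

Context (origin : M) (Horigin : origin ∈ C)
  (Happ_origin : forall y v, app origin y v <-> y ∈ X /\ v = zero).

(* The distance from the origin to the [x]-th unit vector is [r]. *)
Definition norm (x r : M) := exists g, g ∈ C /\
  (forall y, y ∈ X -> (app g y one <-> y = x)) /\ app2 d origin g r.

Lemma norm_ex x : x ∈ X -> exists r, norm x r.
Proof.
  intros Hx; destruct (pairing x x) as [A HA], (indicator X two zero one A Htwo)
    as (g & Hg & Happ); apply HC in Hg.
  destruct (fun2_total _ _ _ _ origin g (proj1 Hd) Horigin Hg) as (r & _ & Hr).
  exists r, g; split; [|split]; auto; intros y Hy; rewrite Happ, (HA y).
  pose proof zero_neq_one; split; [|tauto]; intros (_ & [[H' _]|[_ H']]); [tauto|congruence].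
Qed.

(** Knowing where a function takes the value 1 determines it, since its only other value is 0; so
    the unit vector in [norm] is unique. *)
Lemma norm_unique x r s : norm x r -> norm x s -> r = s.
Proof.
  intros (g & Hg & Happ & Hr) (h & Hh & Happ' & Hs).
  replace h with g in Hs; [eapply fun2_functional; [apply Hd|eauto|eauto]|].
  apply fun_agree_eq; auto; intros y Hy v Hv.
  pose proof (proj1 (HC g) Hg) as Hgf; pose proof (proj1 (HC h) Hh) as Hhf.
  destruct (fun_codom _ _ _ _ _ Hgf Hv) as [_ Hv2].
  destruct (fun_total _ _ _ y Hhf Hy) as (w & Hw2 & Hw).
  apply Htwo in Hv2, Hw2; destruct Hv2 as [-> | ->], Hw2 as [-> | ->]; auto.
  - apply Happ' in Hw as ->; auto; exfalso; apply zero_neq_one.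
    apply (fun_functional _ _ _ x _ _ Hgf); auto; apply Happ; auto.
  - apply Happ in Hv as ->; auto; apply Happ'; auto.
Qed.

(** Distance zero would identify the unit vector with the origin and give the origin the value 1 at
    [x]. *)
Lemma norm_pos x r : x ∈ X -> norm x r -> r ∈ K /\ app lt kzero r.
Proof.
  intros Hx (g & Hg & Happ & Hr).
  destruct Hd as (Hdf & Hnonneg & Hsep & _).
  destruct (fun2_codom _ _ _ _ _ _ _ Hdf Hr) as (_ & _ & HrK); split; auto.
  destruct (lt_total kzero r) as [H|[<-|H]]; auto; [apply HK| |].
  - apply Hsep in Hr as <-; auto; exfalso; apply zero_neq_one.
    symmetry; apply (Happ_origin x), Happ; auto.
  - destruct (Hnonneg origin Horigin g Hg r HrK Hr H).
Qed.

Definition norm_le (x y : M) :=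
  exists r s, norm x r /\ norm y s /\ ~ app lt s r.

Lemma norm_le_total x y : x ∈ X -> y ∈ X -> norm_le x y \/ norm_le y x.
Proof.
  intros Hx Hy; destruct (norm_ex x Hx) as [r Hr], (norm_ex y Hy) as [s Hs].
  destruct (norm_pos x r Hx Hr) as [HrK _], (norm_pos y s Hy Hs) as [HsK _].
  destruct (classic (app lt s r)) as [H|H]; [right; exists s, r|left; exists r, s]; auto.
  repeat split; auto; intros H'; apply (lt_irrefl s HsK), (lt_trans s r s); auto.
Qed.

Lemma norm_le_trans x y z : x ∈ X -> y ∈ X -> z ∈ X ->
  norm_le x y -> norm_le y z -> norm_le x z.
Proof.
  intros Hx Hy Hz (r & s & Hr & Hs & Hrs) (s' & t & Hs' & Ht & Hst).
  rewrite (norm_unique _ _ _ Hs' Hs) in Hst; exists r, t; repeat split; auto.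
  destruct (norm_pos x r Hx Hr) as [HrK _], (norm_pos y s Hy Hs) as [HsK _],
    (norm_pos z t Hz Ht) as [HtK _].
  apply (not_lt_trans r s t); auto.
Qed.

(* An open ball around the origin contains all but finitely many unit vectors. *)
Lemma finite_norm_ge x F : x ∈ X ->
  (forall y, y ∈ F <-> y ∈ X /\ norm_le x y) -> finite_in X F.
Proof.
  intros Hx HF; destruct (norm_ex x Hx) as [r Hr].
  destruct (norm_pos x r Hx Hr) as [HrK Hpos].
  destruct (separation (fun g => exists s, app2 d origin g s /\ app lt s r) C) as [u Hu];
    [definability|].
  assert (u ∈ T) as HuT by (apply (ball_open origin r); auto).
  assert (origin ∈ u) as Ho.
  { apply Hu; split; auto; exists kzero; split; auto.
    apply (proj1 (proj2 (proj2 Hd)) origin Horigin origin Horigin); auto. }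
  destruct (open_box_interior u HuT origin Ho) as (A & HA & H).
  (* For [y] outside [A] the unit vector at [y] vanishes on [A], so it lies in the box of the origin
     and hence in the ball [u] of radius [r]; thus [y] is not in [F]. *)
  apply (finite_subset X A); auto; intros y Hy; apply HF in Hy as (Hy & r' & s & Hr' & Hs & Hle).
  rewrite (norm_unique _ _ _ Hr' Hr) in Hle; apply NNPP; intros HyA.
  destruct Hs as (g & Hg & Happ & Hs); assert (g ∈ u) as Hgu.
  { apply H; auto; intros z Hz v Hv; apply Happ_origin in Hv as [HzX ->].
    pose proof (proj1 (HC g) Hg) as Hgf.
    destruct (fun_total _ _ _ z Hgf HzX) as (w & Hw & Hzw).
    apply Htwo in Hw as [-> | ->]; auto; apply Happ in Hzw as ->; tauto. }
  apply Hu in Hgu as (_ & s' & Hs' & Hlt).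
  rewrite (fun2_functional _ _ _ _ _ _ _ _ (proj1 Hd) Hs' Hs) in Hlt; auto.
Qed.

Lemma metric_cofinal_chain : nonempty X -> exists Fs, chain Fs /\
  (forall F, F ∈ Fs -> finite_in X F) /\
  (forall A, finite_in X A -> exists F, F ∈ Fs /\ subset A F).
Proof.
  intros [x0 Hx0]; destruct (powerset X) as [PX HPX].
  destruct (separation (fun F => exists x, x ∈ X /\
    forall y, y ∈ F <-> y ∈ X /\ norm_le x y) PX) as [Fs HFs]; [definability|].
  exists Fs; split; [|split].
  (* The larger the norm of the index, the smaller the set, so totality of [norm_le] makes the
     family a chain. *)
  - enough (forall a b x y, x ∈ X -> y ∈ X ->
      (forall z, z ∈ a <-> z ∈ X /\ norm_le x z) ->
      (forall z, z ∈ b <-> z ∈ X /\ norm_le y z) -> norm_le x y -> subset b a) as H.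
    { intros a Ha b Hb; apply HFs in Ha as (_ & x & Hx & Ha), Hb as (_ & y & Hy & Hb).
      destruct (norm_le_total x y Hx Hy); eauto. }
    intros a b x y Hx Hy Ha Hb Hxy z Hz; apply Hb in Hz as [Hz Hyz]; apply Ha.
    split; auto; apply (norm_le_trans x y z); auto.
  - intros F HF; apply HFs in HF as (_ & x & Hx & HF); apply (finite_norm_ge x); auto.
  - intros A HA.
    (* A lower bound for the norms on [A] makes its set contain [A]. It need not belong to [A]: the
       induction starts from [x0], which also serves the empty set. *)
    assert (exists x, x ∈ X /\ forall y, y ∈ A -> norm_le x y) as (x & Hx & Hle).
    { pattern A; apply (finite_ind X); auto.
      - definability.
      - intros e He; exists x0; split; auto; intros y Hy; destruct (He y Hy).
      - intros B x B' HB Hx HB' (y & Hy & Hle).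
        assert (norm_le x x) as Hxx by (destruct (norm_le_total x x); auto).
        destruct (norm_le_total x y Hx Hy) as [H|H]; [exists x|exists y]; split; auto;
          intros z Hz; apply HB' in Hz as [Hz| ->]; auto.
        apply (norm_le_trans x y z); auto. }
    destruct (separation (norm_le x) X) as [F HF]; [unfold norm_le; definability|].
    exists F; split.
    + apply HFs; split; eauto; apply HPX; intros y Hy; apply HF, Hy.
    + intros y Hy; apply HF; split; auto; apply HA, Hy.
Qed.

End Metric.
End Cube.

Lemma metrizable_cube_paracompact X C T :
  nonempty X -> is_cantor_cube C T X -> metrizable C T -> paracompact C T.
Proof.
  intros HX (two & S & (zero & one & Hz & Ho & Htwo) & HS & HC & HT)
    (K & add & mul & lt & kzero & kone & [HK _] & d & Hd & Hind).
  destruct empty_ex as [e He].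
  (* The origin is the indicator of the empty set. *)
  destruct (indicator X two zero one e Htwo) as (origin & Hof & Happ).
  destruct (metric_cofinal_chain X C T two S zero one) with (K := K) (add := add)
    (mul := mul) (lt := lt) (kzero := kzero) (kone := kone) (d := d) (origin := origin)
    as (Fs & Hchain & Hfin & Hcof); auto.
  - apply HC, Hof.
  - intros y v; rewrite Happ; pose proof (He y); tauto.
  - apply (cofinal_chain_paracompact X C T two S) with Fs; auto.
Qed.

End Model.

Local Open Scope fml_scope.

Theorem theorem5p7 :
  provable ZF (sentence
    (∀ X C T, Nonempty X ∧ IsCantorCube C T X ∧ Metrizable C T ⇒
      Paracompact C T)).
Proof.
  apply completeness; intros M E env HZF; apply sat_theorem.
  intros X C T (HX & HC & HT); apply (metrizable_cube_paracompact E env HZF X); auto.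
Qed.
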